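(* Let $G$ be a compact group, $K$ a closed subgroup, and let $\phi$ be a continuous, positive definite, bi-$K$-invariant function on $G$. Then there exists a bi-$K$-invariant function $f\in L^2(G)$ such that $\phi=f*\breve f$. Moreover, if $\phi$ is real valued, then $f$ can also be chosen real valued.
   Context: $G$ is a compact (Hausdorff, second countable) topological group with Haar probability measure $dg$ and $K\subset G$ is a closed subgroup. A function $\phi:G\to\mathbb C$ is positive definite if $\sum_{i,j=1}^m\phi(g_i^{-1}g_j)\overline{\xi_i}\xi_j\ge0$ for all $m$, $g_i\in G$, $\xi_i\in\mathbb C$. A function $f$ on $G$ is bi-$K$-invariant if $f(k_1gk_2)=f(g)$ for all $g\in G$, $k_1,k_2\in K$. For functions on $G$, $\breve f(g)=\overline{f(g^{-1})}$ and $(f_1*f_2)(g)=\int_G f_1(h)f_2(h^{-1}g)\,dh$. *)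

(* Defs.v *)
From HB Require Import structures.
From mathcomp Require Import all_boot all_order all_algebra.
From mathcomp Require Import all_classical all_reals all_analysis.
From mathcomp Require Import complex.

Set Implicit Arguments.
Unset Strict Implicit.
Unset Printing Implicit Defensive.

Import Order.TTheory GRing.Theory Num.Theory numFieldTopology.Exports numFieldNormedType.Exports.
Local Open Scope classical_set_scope.
Local Open Scope ring_scope.
Local Open Scope complex_scope.

Notation borelT G := (g_sigma_algebraType (@open G)).

Definition compact_group (G : ptopologicalType) (mul : G -> G -> G)
    (inv : G -> G) (one : G) : Prop :=
  [/\ (forall x y z, mul x (mul y z) = mul (mul x y) z),
      (forall x, mul one x = x) &
      (forall x, mul (inv x) x = one)] /\
  [/\ continuous (fun p : G * G => mul p.1 p.2),
      continuous inv,
      hausdorff_space G,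
      compact [set: G] &
      @second_countable G].

Definition closed_subgroup (G : ptopologicalType) (mul : G -> G -> G)
    (inv : G -> G) (one : G) (K : set G) : Prop :=
  [/\ closed K, K one,
      (forall x y, K x -> K y -> K (mul x y)) &
      (forall x, K x -> K (inv x))].

Definition haar_probability (R : realType) (G : ptopologicalType)
    (mul : G -> G -> G) (mu : {measure set (borelT G) -> \bar R}) : Prop :=
  mu [set: borelT G] = 1%E /\
  (forall (g : G) (A : set (borelT G)), measurable A ->
     mu [set mul g x | x in A] = mu A).

Definition ccontinuous (R : realType) (G : ptopologicalType) (f : G -> R[i]) :=
  continuous (fun x => complex.Re (f x)) /\ continuous (fun x => complex.Im (f x)).

Definition positive_definite (R : realType) (G : Type) (mul : G -> G -> G)
    (inv : G -> G) (phi : G -> R[i]) : Prop :=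
  forall (m : nat) (g : 'I_m -> G) (xi : 'I_m -> R[i]),
    0 <= \sum_(i < m) \sum_(j < m) phi (mul (inv (g i)) (g j)) * (xi i)^* * xi j.

Definition biK_invariant (G A : Type) (mul : G -> G -> G) (K : set G)
    (f : G -> A) : Prop :=
  forall g k1 k2, K k1 -> K k2 -> f (mul (mul k1 g) k2) = f g.

Definition L2 (R : realType) (d : measure_display) (T : measurableType d)
    (mu : {measure set T -> \bar R}) (f : T -> R[i]) : Prop :=
  [/\ measurable_fun [set: T] (fun x => complex.Re (f x)),
      measurable_fun [set: T] (fun x => complex.Im (f x)) &
      (\int[mu]_x ((complex.Re (f x)) ^+ 2 + (complex.Im (f x)) ^+ 2)%:E < +oo)%E].

Definition cintegral (R : realType) (d : measure_display) (T : measurableType d)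
    (mu : {measure set T -> \bar R}) (f : T -> R[i]) : R[i] :=
  (Rintegral mu [set: T] (fun x => complex.Re (f x)))
    +i* (Rintegral mu [set: T] (fun x => complex.Im (f x))).

Definition fcheck (R : realType) (G : Type) (inv : G -> G) (f : G -> R[i]) :
  G -> R[i] := fun g => (f (inv g))^*.

Definition convolution (R : realType) (G : ptopologicalType)
    (mul : G -> G -> G) (inv : G -> G) (mu : {measure set (borelT G) -> \bar R})
    (f1 f2 : G -> R[i]) : G -> R[i] :=
  fun g => cintegral mu (fun h : borelT G => f1 h * f2 (mul (inv h) g)).

(* Main.v *)
Require Import Defs.
From HB Require Import structures.
From mathcomp Require Import all_boot all_order all_algebra.
From mathcomp Require Import all_classical all_reals all_analysis.
From mathcomp Require Import finmap measurable_realfun complex ring lra.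

Import Order.TTheory GRing.Theory Num.Theory numFieldTopology.Exports numFieldNormedType.Exports.
Set Implicit Arguments.
Unset Strict Implicit.
Unset Printing Implicit Defensive.

Local Open Scope classical_set_scope.
Local Open Scope ring_scope.
Local Open Scope complex_scope.

(** In the convolution algebra one seeks a Hermitian square root of [phi],
    normalized by [phi 1 <= 1].  The iteration [f 0 = 0],
    [f (n+1) = f n + (phi - f n * f n) / 2] produces [f n = phi * P_n(1 - phi)],
    where [P_n] and [P_(n+1) - P_n] have nonnegative coefficients.  Let
    [tau(x)] be the value at the identity, so that [tau(x * x)] is the squared
    L2 norm of a Hermitian [x].  Positive definiteness of [phi] makes
    [tau(phi * (1 - phi)^k)] nonnegative and nonincreasing in [k], whence
    [|f n|^2 <= phi 1] and [|f n - f m|^2 <= |f n|^2 - |f m|^2] for [m <= n].  So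
    [f n] converges in L2 to some [f], [f n * f n] converges uniformly to the
    convolution of [f] with its check, and [phi - f n * f n = 2 (f (n+1) - f n)]
    tends to [0] in L2; since Haar measure has full support, the uniform limit
    is [phi]. *)

(** For a number [s] in [0, 1] in place of [phi], this iteration increases to the square root of
    [s]; it stands in for the spectral theory of the operator of convolution by [phi]. The
    convolution algebra has no unit, since that would be the Dirac mass at [one]. Hence polynomials
    in [1 - phi] only occur multiplied by [phi], and positivity of [phi] on a Dirac mass minus a
    density must be extracted from finite sums; averaging over random points does this. Nonnegative
    coefficients then reduce every inequality between polynomials to one about the powers of
    [1 - phi]. The factorization, the invariance and the realness are demanded at every point, while
    an L2 limit is determined only almost everywhere. So the limit is taken as a pointwise limsup
    along a subsequence, which inherits invariance and realness from the iterates, and the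
    factorization is reached through a uniform limit. *)

Local Notation Re := complex.Re.
Local Notation Im := complex.Im.
(* As an argument of [*], [z^*] would otherwise be parsed as [Num.conj]. *)
Local Notation "z ^*" := (conjc z) : ring_scope.
Arguments conjc {R} x : simpl never.

(** * Complex integrals and square norms *)

Definition sqmod (R : realType) (z : R[i]) : R := Re z ^+ 2 + Im z ^+ 2.

Section ComplexParts.
Variable R : realType.
Implicit Types z w : R[i].

Lemma cReD z w : Re (z + w) = Re z + Re w. Proof. by case: z; case: w. Qed.
Lemma cImD z w : Im (z + w) = Im z + Im w. Proof. by case: z; case: w. Qed.
Lemma cReN z : Re (- z) = - Re z. Proof. by case: z. Qed.
Lemma cImN z : Im (- z) = - Im z. Proof. by case: z. Qed.
Lemma cReM z w : Re (z * w) = Re z * Re w - Im z * Im w.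
Proof. by case: z; case: w. Qed.
Lemma cImM z w : Im (z * w) = Re z * Im w + Im z * Re w.
Proof. by case: z; case: w. Qed.
Lemma cReJ z : Re z^* = Re z. Proof. by case: z. Qed.
Lemma cImJ z : Im z^* = - Im z. Proof. by case: z. Qed.

Definition ReImE := (cReD, cImD, cReN, cImN, cReM, cImM, cReJ, cImJ).

Lemma complexP z w : Re z = Re w -> Im z = Im w -> z = w.
Proof. by case: z; case: w => a b c d /= -> ->. Qed.

Lemma cRe_natl n z : Re (n%:R * z) = n%:R * Re z.
Proof. by rewrite !mulr_natl; elim: n => // n ih; rewrite !mulrS cReD ih. Qed.

Lemma sqmod_ge0 z : 0 <= sqmod z.
Proof. by rewrite /sqmod addr_ge0// sqr_ge0. Qed.

Lemma sqmodJ z : sqmod z^* = sqmod z.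
Proof. by rewrite /sqmod !ReImE sqrrN. Qed.

Lemma sqmodN z : sqmod (- z) = sqmod z.
Proof. by rewrite /sqmod !ReImE !sqrrN. Qed.

Lemma sqmodE z : (sqmod z)%:C = z * z^*.
Proof. by apply: complexP; rewrite !ReImE /sqmod /=; ring. Qed.

Lemma sqmodM z w : sqmod (z * w) = sqmod z * sqmod w.
Proof. by rewrite /sqmod !ReImE; ring. Qed.

Lemma Re_sum I (r : seq I) (F : I -> R[i]) :
  Re (\sum_(i <- r) F i) = \sum_(i <- r) Re (F i).
Proof. by elim/big_rec2: _ => // i y1 y2 _ <-; rewrite cReD. Qed.

End ComplexParts.

Section ComplexIntegral.
Context (R : realType) (d : measure_display) (T : measurableType d).
Variable mu : {measure set T -> \bar R}.

Definition cintegrable (f : T -> R[i]) :=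
  mu.-integrable setT (EFin \o (fun x => Re (f x))) /\
  mu.-integrable setT (EFin \o (fun x => Im (f x))).

Implicit Types f g : T -> R[i].

Lemma integrableDR (f g : T -> R) : mu.-integrable setT (EFin \o f) ->
  mu.-integrable setT (EFin \o g) ->
  mu.-integrable setT (EFin \o (fun x => f x + g x)).
Proof. by move=> hf hg; have := integrableD measurableT hf hg. Qed.

Lemma integrableZR (c : R) (f : T -> R) : mu.-integrable setT (EFin \o f) ->
  mu.-integrable setT (EFin \o (fun x => c * f x)).
Proof. by move=> hf; have := integrableZl measurableT c hf. Qed.

Lemma cintegralD f g : cintegrable f -> cintegrable g ->
  cintegral mu (fun x => f x + g x) = cintegral mu f + cintegral mu g.
Proof.
move=> [f1 f2] [g1 g2]; apply: complexP; rewrite ReImE /=.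
  by under eq_Rintegral do rewrite cReD; rewrite RintegralD.
by under eq_Rintegral do rewrite cImD; rewrite RintegralD.
Qed.

Lemma cintegrableZ c f : cintegrable f -> cintegrable (fun x => c * f x).
Proof.
move=> [f1 f2]; split.
  under eq_fun do rewrite cReM -mulNr.
  by apply: integrableDR; exact: integrableZR.
under eq_fun do rewrite cImM.
by apply: integrableDR; exact: integrableZR.
Qed.

Lemma cintegralZ c f : cintegrable f ->
  cintegral mu (fun x => c * f x) = c * cintegral mu f.
Proof.
move=> [f1 f2]; apply: complexP; rewrite ReImE /=.
  under eq_Rintegral do rewrite cReM -mulNr.
  by rewrite RintegralD ?RintegralZl ?mulNr//; exact: integrableZR.
under eq_Rintegral do rewrite cImM.
by rewrite RintegralD ?RintegralZl//; exact: integrableZR.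
Qed.

Lemma cintegralJ f : cintegrable f ->
  cintegral mu (fun x => (f x)^*) = (cintegral mu f)^*.
Proof.
move=> [f1 f2]; apply: complexP; rewrite ReImE /=.
  by under eq_Rintegral do rewrite cReJ.
by under eq_Rintegral do rewrite cImJ -mulN1r; rewrite RintegralZl ?mulN1r.
Qed.

Lemma eq_cintegral f g : (forall x, f x = g x) ->
  cintegral mu f = cintegral mu g.
Proof. by move=> fg; congr (cintegral _ _); apply/funext. Qed.

End ComplexIntegral.

Section SquareNorm.
Context (R : realType) (d : measure_display) (T : measurableType d).
Variable mu : {measure set T -> \bar R}.

Definition cmeasurable (f : T -> R[i]) :=
  measurable_fun setT (fun x => Re (f x)) /\
  measurable_fun setT (fun x => Im (f x)).

Implicit Types f g : T -> R[i].

Lemma cmeasurableD f g : cmeasurable f -> cmeasurable g ->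
  cmeasurable (fun x => f x + g x).
Proof.
move=> [f1 f2] [g1 g2]; split.
  by under eq_fun do rewrite cReD; exact: measurable_funD.
by under eq_fun do rewrite cImD; exact: measurable_funD.
Qed.

Lemma cmeasurableM f g : cmeasurable f -> cmeasurable g ->
  cmeasurable (fun x => f x * g x).
Proof.
move=> [f1 f2] [g1 g2]; split.
  by under eq_fun do rewrite cReM; apply: measurable_funB; exact: measurable_funM.
by under eq_fun do rewrite cImM; apply: measurable_funD; exact: measurable_funM.
Qed.

Lemma cmeasurable_cst c : cmeasurable (fun _ => c).
Proof. by split; exact: measurable_cst. Qed.

Lemma cmeasurableN f : cmeasurable f -> cmeasurable (fun x => - f x).
Proof.
move=> mf; under eq_fun do rewrite -mulN1r.
by apply: cmeasurableM => //; exact: cmeasurable_cst.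
Qed.

Lemma cmeasurableJ f : cmeasurable f -> cmeasurable (fun x => (f x)^*).
Proof.
move=> [f1 f2]; split; first by under eq_fun do rewrite cReJ.
by under eq_fun do rewrite cImJ; exact: measurableT_comp.
Qed.

Lemma measurable_sqmod f : cmeasurable f ->
  measurable_fun setT (fun x => sqmod (f x)).
Proof.
by move=> [f1 f2]; apply: measurable_funD; exact: measurable_funX.
Qed.

Definition sqnorm f : \bar R := (\int[mu]_x (sqmod (f x))%:E)%E.

Lemma sqnorm_ge0 f : (0 <= sqnorm f)%E.
Proof. by apply: integral_ge0 => x _; rewrite lee_fin sqmod_ge0. Qed.

(* The weights in [2 |z w| <= (M/e) |z|^2 + (e/M) |w|^2] balance the two norms. *)
Lemma normr_Rintegral_mul f g (e M : R) : cmeasurable f -> cmeasurable g ->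
  0 < e -> 0 < M -> (sqnorm f <= (e ^+ 2)%:E)%E -> (sqnorm g <= (M ^+ 2)%:E)%E ->
  `|\int[mu]_x Re (f x * g x)| <= e * M.
Proof.
move=> mf mg e0 M0 nf ng.
have [mfg _] := cmeasurableM mf mg.
pose h x := M / e / 2 * sqmod (f x) + e / M / 2 * sqmod (g x).
have c1 : 0 <= M / e / 2 by rewrite !divr_ge0// ltW.
have c2 : 0 <= e / M / 2 by rewrite !divr_ge0// ltW.
have h0 x : 0 <= h x by rewrite addr_ge0// mulr_ge0// sqmod_ge0.
have fgh x : `|Re (f x * g x)| <= h x.
  have eM : e / M / 2 = (M / e / 2)^-1 / 4 by field; rewrite !gt_eqF.
  have k0 : 0 < M / e / 2 by rewrite !divr_gt0.
  rewrite /h eM; move: (M / e / 2) k0 => k k0.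
  rewrite cReM /sqmod; case: (f x) => a b; case: (g x) => p q /=.
  (* Multiplied by [4 * k], the two bounds say that [(2 k a + p)^2 + (2 k b - q)^2] and
     [(2 k a - p)^2 + (2 k b + q)^2] are nonnegative. *)
  rewrite -(ler_pM2l (_ : 0 < 4 * k)); last by rewrite mulr_gt0.
  rewrite mulrDr [X in _ <= _ + X](_ : _ = p ^+ 2 + q ^+ 2); last first.
    by field; rewrite gt_eqF.
  rewrite -[X in X * _]gtr0_norm ?mulr_gt0// -normrM ler_norml; apply/andP; split.
    have := sqr_ge0 (2 * k * a + p); have := sqr_ge0 (2 * k * b - q); lra.
  have := sqr_ge0 (2 * k * a - p); have := sqr_ge0 (2 * k * b + q); lra.
have mh : measurable_fun setT h.
  by apply: measurable_funD; apply: measurable_funM => //; exact: measurable_sqmod.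
have mZ k u : cmeasurable u ->
    measurable_fun setT (fun x => (k * sqmod (u x))%:E).
  move=> mu'; apply/measurable_EFinP; apply: measurable_funM => //.
  exact: measurable_sqmod.
have iZ k u : 0 <= k -> cmeasurable u ->
    (\int[mu]_x (k * sqmod (u x))%:E = k%:E * sqnorm u)%E.
  move=> k0 mu'; under eq_integral do rewrite EFinM.
  rewrite ge0_integralZl ?lee_fin//.
    by apply/measurable_EFinP; exact: measurable_sqmod.
  by move=> x _; rewrite lee_fin sqmod_ge0.
have hle : (\int[mu]_x (h x)%:E <= (e * M)%:E)%E.
  under eq_integral do rewrite EFinD.
  rewrite ge0_integralD ?iZ//; try exact: mZ;
    try by move=> x _; rewrite lee_fin mulr_ge0// sqmod_ge0.
  apply: (@le_trans _ _ ((M / e / 2)%:E * (e ^+ 2)%:E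
                         + (e / M / 2)%:E * (M ^+ 2)%:E)%E).
    by apply: leeD; apply: lee_wpmul2l.
  rewrite -!EFinM -EFinD lee_fin le_eqVlt; apply/orP; left; apply/eqP.
  by field; rewrite !gt_eqF.
have ih : mu.-integrable setT (EFin \o h).
  apply/integrableP; split; first exact/measurable_EFinP.
  under eq_integral do rewrite /= ger0_norm//.
  by rewrite (le_lt_trans hle)// ltry.
have ifg : mu.-integrable setT (EFin \o (fun x => Re (f x * g x))).
  apply: le_integrable ih => //; first exact/measurable_EFinP.
  by move=> x _ /=; rewrite lee_fin (le_trans (fgh x))// ler_norm.
apply: (le_trans (le_normr_Rintegral _ ifg)) => //.
apply: (@le_trans _ _ (\int[mu]_x h x)).
  apply: le_Rintegral => //.
  by apply: (le_integrable _ _ _ ifg) => //= [|x _];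
    [apply/measurable_EFinP; exact: measurableT_comp|rewrite normr_id].
rewrite -lee_fin /Rintegral fineK//.
exact: (integrable_fin_num measurableT ih).
Qed.

Lemma cintegrableM f g : cmeasurable f -> cmeasurable g ->
  (sqnorm f < +oo)%E -> (sqnorm g < +oo)%E ->
  cintegrable mu (fun x => f x * g x).
Proof.
move=> mf mg nf ng.
have [mr mi] := cmeasurableM mf mg.
pose h x := sqmod (f x) + sqmod (g x).
have h0 x : 0 <= h x by rewrite addr_ge0// sqmod_ge0.
have ih : mu.-integrable setT (EFin \o h).
  apply: integrableDR; apply/integrableP; split;
    try (by apply/measurable_EFinP; exact: measurable_sqmod).
  - by under eq_integral do rewrite /= ger0_norm ?sqmod_ge0//.
  - by under eq_integral do rewrite /= ger0_norm ?sqmod_ge0//.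
have dom (k : T -> R) : measurable_fun setT k -> (forall x, `|k x| <= h x) ->
    mu.-integrable setT (EFin \o k).
  move=> mk kh; apply: (le_integrable _ _ _ ih) => //; first exact/measurable_EFinP.
  by move=> x _; rewrite lee_fin (le_trans (kh x))// ler_norm.
(* One pool of squares serves all four inequalities: both signs for both parts. *)
by split; apply: dom => // x;
  rewrite !ReImE /h /sqmod; case: (f x) => a b; case: (g x) => p q /=;
  rewrite ler_norml; apply/andP; split;
  have := sqr_ge0 (a + q); have := sqr_ge0 (b - p);
  have := sqr_ge0 (a - q); have := sqr_ge0 (b + p);
  have := sqr_ge0 (a + p); have := sqr_ge0 (b - q);
  have := sqr_ge0 (a - p); have := sqr_ge0 (b + q); lra.
Qed.

End SquareNorm.

Section SquareNormArithmetic.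
Context (R : realType) (d : measure_display) (T : measurableType d).
Variable mu : {measure set T -> \bar R}.
Implicit Types f g : T -> R[i].

Lemma cmeasurableB f g : cmeasurable f -> cmeasurable g ->
  cmeasurable (fun x => f x - g x).
Proof. by move=> mf mg; apply: cmeasurableD => //; exact: cmeasurableN. Qed.

Lemma cmeasurableZ (c : R[i]) f : cmeasurable f -> cmeasurable (fun x => c * f x).
Proof. by move=> mf; apply: cmeasurableM => //; exact: cmeasurable_cst. Qed.

Lemma sqnormZ c f : cmeasurable f ->
  sqnorm mu (fun x => c * f x) = ((sqmod c)%:E * sqnorm mu f)%E.
Proof.
move=> mf; rewrite /sqnorm; under eq_integral do rewrite sqmodM EFinM.
rewrite ge0_integralZl//.
- by apply/measurable_EFinP; exact: measurable_sqmod.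
- by move=> x _; rewrite lee_fin sqmod_ge0.
- by rewrite lee_fin sqmod_ge0.
Qed.

Lemma sqnormJ f : sqnorm mu (fun x => (f x)^*) = sqnorm mu f.
Proof. by rewrite /sqnorm; under eq_integral do rewrite sqmodJ. Qed.

Lemma sqnormBC f g :
  sqnorm mu (fun x => f x - g x) = sqnorm mu (fun x => g x - f x).
Proof.
by rewrite /sqnorm; under eq_integral do rewrite -opprB sqmodN.
Qed.

(** A triangle inequality without square roots: the two sides differ by the integral of the squared
    modulus of [2 f - g]. *)
Lemma sqnorm_le_add f g : cmeasurable f -> cmeasurable g ->
  (sqnorm mu g <= 2%:E * sqnorm mu f
    + 2%:E * sqnorm mu (fun x => f x - g x)%R)%E.
Proof.
move=> mf mg.
have mfg := cmeasurableB mf mg.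
have msq (k : T -> R[i]) : cmeasurable k -> measurable_fun setT (fun x : T => (sqmod (k x))%:E).
  by move=> mk; apply/measurable_EFinP; exact: measurable_sqmod.
rewrite /sqnorm -!ge0_integralZl//; try exact: msq;
  try by move=> x _; rewrite lee_fin sqmod_ge0.
have e0 (k : T -> R[i]) x : (0 <= 2%:E * (sqmod (k x))%:E)%E.
  by rewrite -EFinM lee_fin mulr_ge0// sqmod_ge0.
have p1 := fun x (_ : [set: T] x) => e0 f x.
have p2 := fun x (_ : [set: T] x) => e0 (fun x => f x - g x) x.
have q1 := measurable_funeM 2%:E (msq _ mf : measurable_fun setT _).
have q2 := measurable_funeM 2%:E (msq _ mfg : measurable_fun setT _).
rewrite -ge0_integralD//.
apply: ge0_le_integral => //.
- by move=> x _; rewrite lee_fin sqmod_ge0.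
- exact: msq.
- by apply: emeasurable_funD; apply: measurable_funeM; exact: msq.
- move=> x _; rewrite -!EFinM -EFinD lee_fin /sqmod !ReImE.
  have := sqr_ge0 (2 * Re (f x) - Re (g x)).
  by have := sqr_ge0 (2 * Im (f x) - Im (g x)); lra.
Qed.

End SquareNormArithmetic.

(** * Completeness of L2 *)

Section L2Limit.
Context (R : realType) (d : measure_display) (T : measurableType d).
Variable mu : {measure set T -> \bar R}.
Hypothesis mu1 : mu setT = 1%E.

(* Taking [fine] of the pointwise limsup makes the limit total, measurable, and
   a function of the sequence of values alone. *)
Definition limsup_fun (u : nat -> T -> R) (x : T) : R :=
  fine (limn_esup (fun n => (u n x)%:E)).

Lemma measurable_limsup_fun (u : nat -> T -> R) :
  (forall n, measurable_fun setT (u n)) -> measurable_fun setT (limsup_fun u).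
Proof.
move=> mu'; apply: measurableT_comp; first exact: fine_measurable.
by apply: measurable_fun_limn_esup => n; exact/measurable_EFinP.
Qed.

(** Bounded variation makes the telescoping series converge absolutely, so the values have a finite
    limit, and the limsup agrees with it. *)
Lemma cvg_limsup_fun (u : nat -> T -> R) (C : R) x :
  (forall n, \sum_(0 <= k < n) `|u k.+1 x - u k x| <= C) ->
  u n x @[n --> \oo] --> limsup_fun u x.
Proof.
move=> uC.
have cu : cvgn (fun n => u n x).
  rewrite (_ : (fun n => u n x) = cst (u 0%N x) \+ series (telescope (u^~ x))).
    apply: is_cvgD; first exact: is_cvg_cst.
    apply: normed_cvg; apply: nondecreasing_is_cvgn.
      by apply: nondecreasing_series => n _ /=.
    by exists C => _ [n _ <-]; exact: uC.
  by apply/funext => n; rewrite (eq_sum_telescope (u^~ x)).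
have [l ul] := (cvg_ex _).1 cu.
suff -> : limsup_fun u x = l by [].
rewrite /limsup_fun.
have /cvg_limn_einf_sup[_ ->] // : (u n x)%:E @[n --> \oo] --> l%:E.
by apply: cvg_EFin => //; exact: nearW.
Qed.

(** The rate [4^-k] for squares gives increments of L1 norm at most [2^-k]. Their sum is integrable,
    hence finite almost everywhere, which gives pointwise convergence; Fatou's lemma then transfers
    the Cauchy bound to the limit. *)
Lemma L2_cauchy_limit (u : nat -> T -> R) :
  (forall n, measurable_fun setT (u n)) ->
  (forall k m n, (k <= m)%N -> (k <= n)%N ->
    (\int[mu]_x ((u m x - u n x) ^+ 2)%:E <= ((4^-1) ^+ k)%:E)%E) ->
  forall n, (\int[mu]_x ((u n x - limsup_fun u x) ^+ 2)%:E <= ((4^-1) ^+ n)%:E)%E.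
Proof.
move=> mu' hu n0.
pose dd k x := `|u k.+1 x - u k x|.
have mdd k : measurable_fun setT (dd k).
  by apply: measurableT_comp => //; exact: measurable_funB.
have idd k : (\int[mu]_x (dd k x)%:E <= ((2^-1) ^+ k)%:E)%E.
  (* With [c = 2^-k / 2] and [b = 2^k / 2], [|t| <= c + b t^2] by completing the square. Since the
     total mass is 1, the integral is at most [c + b 4^-k = 2^-k]. *)
  have [c c0 cE] : exists2 c : R, 0 <= c & c = (2^-1) ^+ k / 2.
    by eexists; last reflexivity; rewrite divr_ge0// exprn_ge0// invr_ge0.
  have [b b0 bE] : exists2 b : R, 0 <= b & b = 2 ^+ k / 2.
    by eexists; last reflexivity; rewrite divr_ge0// exprn_ge0.
  pose h x := c + b * (u k.+1 x - u k x) ^+ 2.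
  have mdsq : measurable_fun setT (fun x => ((u k.+1 x - u k x) ^+ 2)%:E).
    by apply/measurable_EFinP; apply: measurable_funX; exact: measurable_funB.
  have ih : (\int[mu]_x (h x)%:E <= ((2^-1) ^+ k)%:E)%E.
    under eq_integral do rewrite EFinD EFinM.
    rewrite ge0_integralD//; last 2 first.
    - by move=> x _; rewrite -EFinM lee_fin mulr_ge0 ?sqr_ge0.
    - by apply/measurable_EFinP; apply: measurable_funM => //;
        apply: measurable_funX; exact: measurable_funB.
    rewrite integral_cst// [X in (_ * X)%E]mu1 mule1 ge0_integralZl//; last first.
      by move=> x _; rewrite lee_fin sqr_ge0.
    apply: (@le_trans _ _ (c%:E + b%:E * ((4^-1) ^+ k)%:E)%E).
      by apply: leeD => //; apply: lee_wpmul2l; [rewrite lee_fin|exact: hu].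
    rewrite -EFinM -EFinD lee_fin le_eqVlt; apply/orP; left; apply/eqP.
    rewrite {}cE {}bE.
    have -> : (4^-1 : R) = 2^-1 * 2^-1 by field.
    rewrite exprMn exprVn; field; exact/expf_neq0.
  apply: le_trans ih; apply: ge0_le_integral => //.
  - by move=> x _; rewrite lee_fin normr_ge0.
  - by apply/measurable_EFinP.
  - by apply/measurable_EFinP; apply: measurable_funD => //; apply: measurable_funM => //;
       apply: measurable_funX; exact: measurable_funB.
  - move=> x _; rewrite lee_fin /dd /h cE bE; set a := u k.+1 x - u k x.
    have k0 : 0 < (2 : R) ^+ k by rewrite exprn_gt0.
    rewrite exprVn -(ler_pM2l (_ : 0 < 2 * 2 ^+ k)) ?mulr_gt0//.
    rewrite [leRHS](_ : _ = 1 + (2 ^+ k * a) ^+ 2); last by field; rewrite gt_eqF.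
    have -> : (2 ^+ k * a) ^+ 2 = (2 ^+ k * `|a|) ^+ 2.
      by rewrite !exprMn real_normK// num_real.
    by have := sqr_ge0 (2 ^+ k * `|a| - 1); lra.
pose S x := (\sum_(0 <= k <oo) (dd k x)%:E)%E.
have dd0 k x : (0 <= (dd k x)%:E)%E by rewrite lee_fin normr_ge0.
have iS : mu.-integrable setT S.
  apply/integrableP; split.
    by apply: ge0_emeasurable_sum => [k x _ _|k _]; [exact: dd0|exact/measurable_EFinP].
  under eq_integral do rewrite gee0_abs ?nneseries_ge0//.
  rewrite integral_nneseries//; last by move=> k; exact/measurable_EFinP.
  apply: (@le_lt_trans _ _ (\sum_(0 <= k <oo) ((2^-1) ^+ k)%:E)%E).
    by apply: lee_nneseries => // k _ _; exact: integral_ge0.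
  have : eseries (fun k => ((2^-1 : R) ^+ k)%:E) @ \oo --> (2 : R)%:E.
    apply: cvg_EFin; first by apply: nearW => n; rewrite /eseries/= sumEFin.
    rewrite (_ : _ \o _ = series (geometric 1 (2^-1))).
      rewrite [X in _ --> X](_ : _ = 1 * (1 - 2^-1)^-1); last by field.
      by apply: cvg_geometric_series; rewrite ger0_norm// invf_lt1// ltr1n.
    apply/funext => n; rewrite /eseries/series/= sumEFin.
    by apply: eq_bigr => i _; rewrite mul1r.
  by move/cvg_lim => ->//; rewrite ltry.
have aecvg : {ae mu, forall x, setT x -> u n x @[n --> \oo] --> limsup_fun u x}.
  have := integrable_ae measurableT iS; apply: filterS => x /(_ I) Sfin _.
  apply: (@cvg_limsup_fun _ (fine (S x))) => n.
  rewrite -lee_fin fineK// -sumEFin.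
  by rewrite /S; apply: nneseries_lim_ge.
have mg := measurable_limsup_fun mu'.
pose w n x := ((u n0 x - u n x) ^+ 2)%:E.
have mw n : measurable_fun setT (w n).
  by apply/measurable_EFinP; apply: measurable_funX; exact: measurable_funB.
have w0 n x : (0 <= w n x)%E by rewrite lee_fin sqr_ge0.
apply: (@le_trans _ _ (\int[mu]_x limn_einf (w^~ x))%E).
  rewrite le_eqVlt; apply/orP; left; apply/eqP; apply: ge0_ae_eq_integral => //.
  - by apply/measurable_EFinP; apply: measurable_funX; exact: measurable_funB.
  - under eq_fun do rewrite limn_einf_lim -limn_einf_lim /limn_einf.
    apply: measurableT_comp => //; apply: measurable_fun_limn_esup => n.
    exact: measurableT_comp.
  - by move=> x _; rewrite lee_fin sqr_ge0.
  - move=> x _; rewrite limn_einf_lim; apply: lime_ge; first exact: is_cvg_einfs.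
    by apply: nearW => n; apply: le_ereal_inf_tmp => _ [m _ <-].
  - apply: filterS aecvg => x cux /cux cu.
    suff /cvg_limn_einf_sup[-> _] : w n x @[n --> \oo] --> ((u n0 x - limsup_fun u x) ^+ 2)%:E by [].
    apply: cvg_EFin; first exact: nearW.
    by rewrite /w/=; apply: (cvgM (cvgB (cvg_cst _) cu) (cvgB (cvg_cst _) cu)).
apply: (le_trans (fatou mu measurableT mw (fun n x _ => w0 n x))).
rewrite limn_einf_lim; apply: lime_le; first exact: is_cvg_einfs.
apply: nearW => n.
(* The infimum over the tail from [n] is bounded by one term, whose index is also at least [n0] so
   that the Cauchy bound applies. *)
apply: (@le_trans _ _ (\int[mu]_x w (maxn n n0) x)%E).
  by apply: ereal_inf_lbound; exists (maxn n n0) => //=; rewrite leq_maxl.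
by apply: hu => //; rewrite leq_maxr.
Qed.

(** The factor 2 comes from treating real and imaginary parts separately. The limit is given
    explicitly so that its pointwise properties can be read off from those of [u]. *)
Lemma sqnorm_cauchy_limit (u : nat -> T -> R[i]) :
  (forall n, cmeasurable (u n)) ->
  (forall k m n, (k <= m)%N -> (k <= n)%N ->
    (sqnorm mu (fun x => u m x - u n x)%R <= ((4^-1) ^+ k)%:E)%E) ->
  let g x := limsup_fun (fun n x => Re (u n x)) x
             +i* limsup_fun (fun n x => Im (u n x)) x in
  cmeasurable g /\
  forall n, (sqnorm mu (fun x => u n x - g x)%R <= (2 * (4^-1) ^+ n)%:E)%E.
Proof.
move=> mu' hu g.
have mr n : measurable_fun setT (fun x => Re (u n x)) by case: (mu' n).
have mi n : measurable_fun setT (fun x => Im (u n x)) by case: (mu' n).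
have mgr := measurable_limsup_fun mr; have mgi := measurable_limsup_fun mi.
split=> // n.
have dom (p : R[i] -> R) : (forall z w, p (z - w) = p z - p w) ->
    (forall z, p z ^+ 2 <= sqmod z) ->
    (forall n, measurable_fun setT (fun x => p (u n x))) ->
    forall k m n, (k <= m)%N -> (k <= n)%N ->
    (\int[mu]_x ((p (u m x) - p (u n x)) ^+ 2)%:E <= ((4^-1) ^+ k)%:E)%E.
  move=> pB ps mp k a b ka kb; apply: le_trans (hu k a b ka kb).
  apply: ge0_le_integral => //.
  - by move=> x _; rewrite lee_fin sqr_ge0.
  - by apply/measurable_EFinP; apply: measurable_funX; exact: measurable_funB.
  - apply/measurable_EFinP; apply: measurable_sqmod.
    by apply: cmeasurableD => //; exact: cmeasurableN.
  - by move=> x _; rewrite lee_fin -pB.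
have hr := @L2_cauchy_limit (fun n x => Re (u n x)) mr.
have hi := @L2_cauchy_limit (fun n x => Im (u n x)) mi.
have reB z w : Re (z - w) = Re z - Re w :> R by rewrite !ReImE.
have imB z w : Im (z - w) = Im z - Im w :> R by rewrite !ReImE.
have re_le z : Re z ^+ 2 <= sqmod z :> R by rewrite /sqmod lerDl sqr_ge0.
have im_le z : Im z ^+ 2 <= sqmod z :> R by rewrite /sqmod lerDr sqr_ge0.
have dhr := dom _ reB re_le mr; have dhi := dom _ imB im_le mi.
rewrite /sqnorm (_ : 2 * (4^-1) ^+ n = (4^-1) ^+ n + (4^-1) ^+ n); last by ring.
under eq_integral do rewrite /sqmod !ReImE EFinD.
rewrite ge0_integralD//; last 4 first.
- by move=> x _; rewrite lee_fin sqr_ge0.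
- by apply/measurable_EFinP; apply: measurable_funX; exact: measurable_funB.
- by move=> x _; rewrite lee_fin sqr_ge0.
- by apply/measurable_EFinP; apply: measurable_funX; exact: measurable_funB.
rewrite EFinD; apply: leeD.
  exact: (hr (dhr)).
exact: (hi (dhi)).
Qed.

End L2Limit.

(** * Continuous functions on a compact space *)

Section ProbabilityOfMeasure.
Context (R : realType) (d : measure_display) (T : measurableType d).
Variables (mu : {measure set T -> \bar R}) (mu1 : mu setT = 1%E).

(** A copy of [mu] carrying the structure of a probability measure, as needed for product measures
    and Fubini's theorem. The proof of total mass 1 is an argument so that the instance can be
    attached to it. *)
Definition prob_of of mu setT = 1%E : set T -> \bar R := mu.
HB.instance Definition _ := Measure.on (prob_of mu1).
HB.instance Definition _ := Measure_isProbability.Build _ _ _ (prob_of mu1) mu1.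

End ProbabilityOfMeasure.

Section BorelContinuous.
Context (R : realType).

Lemma measurable_fun_gt d (T : measurableType d) (h : T -> R) :
  (forall a, measurable [set x | a < h x]) -> measurable_fun setT h.
Proof.
move=> ha mD; apply: (measurability _ (RGenOInfty.measurableE R)) => //.
by move=> /= _ [_ [a ->] <-]; rewrite setTI preimage_itvoy.
Qed.

Lemma open_preimage_gt (G : topologicalType) (h : G -> R) a :
  continuous h -> open [set x | a < h x].
Proof.
move=> ch; rewrite (_ : [set x | _] = h @^-1` [set y | a < y])//.
by apply: open_comp => //; exact: open_gt.
Qed.

Lemma measurable_open (G : ptopologicalType) (A : set (borelT G)) :
  @open G A -> measurable A.
Proof. exact: sub_sigma_algebra. Qed.

Lemma continuous_borel (G : ptopologicalType) (h : G -> R) :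
  continuous h -> measurable_fun setT (h : borelT G -> R).
Proof.
move=> ch; apply: measurable_fun_gt => a; apply: measurable_open.
exact: open_preimage_gt.
Qed.

(** The product of the Borel sigma-algebras could be smaller than the Borel sigma-algebra of the
    product. Second countability rules this out: an open set is a countable union of rectangles with
    basic open sides. *)
Lemma measurable_open_prod (G : ptopologicalType) (A : set (borelT G * borelT G)) :
  @second_countable G -> @open (G * G)%type A -> measurable A.
Proof.
move=> [B cB [Bo Bbase]] oA.
have B0 : B !=set0.
  have : nbhs (point : G) setT by exact: filterT.
  by move=> /Bbase[U [BU _] _]; exists U.
have [f fB fsurj] : exists2 f : nat -> set G, forall n, B (f n) &
    forall U, B U -> exists n, f n = U.
  move: cB => /pfcard_geP[B00|[f]]; first by case: B0 => U; rewrite B00.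
  exists f; first by move=> n; exact: funS.
  by move=> U BU; have [n _ <-] := 'surj_f BU; exists n.
rewrite (_ : A = \bigcup_n \bigcup_(m in [set m | f n `*` f m `<=` A]) (f n `*` f m)).
  apply: bigcupT_measurable => n; apply: bigcup_measurable => m _.
  by apply: measurableX; apply: measurable_open; exact: Bo.
apply/seteqP; split=> [[x y] Axy|z [n _ [m/= fA fz]]]; last exact: fA.
move: oA; rewrite openE => /(_ _ Axy)[[P Q] [/= Px Qy] PQ].
have [U [BU Ux] UP] := Bbase _ _ Px; have [V [BV Vy] VQ] := Bbase _ _ Qy.
have [n fn] := fsurj _ BU; have [m fm] := fsurj _ BV.
exists n => //; exists m; rewrite /= fn fm//.
by move=> [a b] [/= /UP Pa /VQ Qb]; exact: PQ.
Qed.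

Lemma continuous_borel_prod (G : ptopologicalType) (h : G * G -> R) :
  @second_countable G -> continuous h ->
  measurable_fun setT (h : borelT G * borelT G -> R).
Proof.
move=> sc ch; apply: measurable_fun_gt => a; apply: measurable_open_prod => //.
exact: open_preimage_gt.
Qed.

Lemma compact_continuous_bounded (G : topologicalType) (h : G -> R) :
  compact [set: G] -> continuous h -> [bounded h x | x in [set: G]].
Proof.
move=> cG ch.
have : compact (h @` setT).
  by apply: continuous_compact => //; exact: continuous_subspaceT.
move=> /compact_bounded[M [Mr hM]]; exists M; split=> // N MN x _.
by apply: (hM N MN); exists x.
Qed.

Lemma continuous_integrable (G : ptopologicalType)
    (mu : {measure set (borelT G) -> \bar R}) (h : G -> R) :
  compact [set: G] -> (mu setT < +oo)%E -> continuous h ->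
  mu.-integrable setT (EFin \o (h : borelT G -> R)).
Proof.
move=> cG muf ch; apply: measurable_bounded_integrable => //.
  exact: continuous_borel.
exact: compact_continuous_bounded.
Qed.

(** By compactness, [F (x, y)] tends to [F (x0, y)] uniformly in [y]; on a space of mass 1 the
    integrals then differ by no more than the uniform distance. *)
Lemma continuous_Rintegral (G : ptopologicalType)
    (mu : {measure set (borelT G) -> \bar R}) (F : G * G -> R) :
  compact [set: G] -> mu setT = 1%E -> continuous F ->
  continuous (fun x : G => \int[mu]_y F (x, y)).
Proof.
move=> cG mu1 cF x0; apply/cvgrPdist_le => /= e e0.
have mufin : (mu setT < +oo)%E by rewrite mu1 ltry.
have cFx x : continuous (fun y => F (x, y)).
  move=> y; apply: (@continuous_comp _ _ _ (fun y : G => (x, y)) F y); last exact: cF.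
  by apply: cvg_pair; [exact: cvg_cst|exact: cvg_id].
have iF x : mu.-integrable setT (EFin \o (fun y : borelT G => F (x, y))).
  exact: continuous_integrable.
have key : \forall x \near x0, [set: G] `<=` (fun y => `|F (x0, y) - F (x, y)| <= e).
  apply: ((compact_near_coveringP [set: G]).1 cG) => y _.
  have : (fun q : G * G => F (x0, q.1) - F (q.2, q.1)) q @[q --> (y, x0)] -->
      F (x0, y) - F (x0, y).
    apply: cvgB.
      apply: (@cvg_comp _ _ _ (fun q : G * G => (x0, q.1)) F _ (nbhs (x0, y))).
        by apply: cvg_pair; [exact: cvg_cst|exact: cvg_fst].
      exact: cF.
    apply: (@cvg_comp _ _ _ (fun q : G * G => (q.2, q.1)) F _ (nbhs (x0, y))).
      by apply: cvg_pair; [exact: cvg_snd|exact: cvg_fst].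
    exact: cF.
  rewrite subrr => /cvgrPdist_le/(_ e e0).
  by apply: filterS => -[a b] /=; rewrite sub0r normrN.
near=> x.
have Fx : [set: G] `<=` (fun y => `|F (x0, y) - F (x, y)| <= e) by near: x.
rewrite -RintegralB//.
have iB : mu.-integrable setT (EFin \o (fun y : borelT G => F (x0, y) - F (x, y))).
  exact: (integrableB measurableT (iF x0) (iF x)).
apply: (le_trans (le_normr_Rintegral measurableT iB)).
apply: (@le_trans _ _ (\int[mu]_(y in setT) e)).
  apply: le_Rintegral => //.
  - exact: (integrable_norm iB).
  - by apply: continuous_integrable => //; exact: cst_continuous.
by rewrite /Rintegral integral_cst// [X in (_ * X)%E]mu1 mule1.
Unshelve. all: by end_near. Qed.

Lemma Rintegral_swap (G : ptopologicalType)
    (mu : {measure set (borelT G) -> \bar R}) (F : G * G -> R) :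
  compact [set: G] -> @second_countable G -> mu setT = 1%E -> continuous F ->
  \int[mu]_x \int[mu]_y F (x, y) = \int[mu]_y \int[mu]_x F (x, y).
Proof.
move=> cG sc mu1 cF.
pose P : probability (borelT G) R := prob_of mu1.
have mF := continuous_borel_prod sc cF.
have cG2 : compact [set: G * G] by rewrite -setXTT; exact: compact_setX.
have PP : ((P \x P) [set: borelT G * borelT G] < +oo)%E.
  rewrite -setXTT.
  have := @product_measure1E _ _ _ _ _ P P setT setT measurableT measurableT.
  move=> ->; rewrite [X in (X < _)%E](etrans (congr2 mule mu1 mu1) (mule1 _)).
  exact: ltry.
have iF : (P \x P)%E.-integrable setT
    (EFin \o (F : borelT G * borelT G -> R)).
  apply: measurable_bounded_integrable => //.
  exact: (@compact_continuous_bounded (G * G)%type F cG2 cF).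
have sec x : mu.-integrable setT (EFin \o (fun y : borelT G => F (x, y))).
  apply: continuous_integrable => //; first by rewrite mu1 ltry.
  move=> y; apply: (@continuous_comp _ _ _ (fun y : G => (x, y)) F y); last exact: cF.
  by apply: cvg_pair; [exact: cvg_cst|exact: cvg_id].
have sec' y : mu.-integrable setT (EFin \o (fun x : borelT G => F (x, y))).
  apply: continuous_integrable => //; first by rewrite mu1 ltry.
  move=> x; apply: (@continuous_comp _ _ _ (fun x : G => (x, y)) F x); last exact: cF.
  by apply: cvg_pair; [exact: cvg_id|exact: cvg_cst].
have := Fubini iF; rewrite /Rintegral.
(* [Rintegral] puts a [fine] around the inner integral; it can be removed because every section is
   integrable. *)
have -> : (\int[mu]_x (fine (\int[mu]_y (F (x, y))%:E))%:E =
           \int[P]_x \int[P]_y (F (x, y))%:E)%E.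
  by apply: eq_integral => x _; rewrite fineK//; exact: integrable_fin_num (sec x).
have -> : (\int[mu]_y (fine (\int[mu]_x (F (x, y))%:E))%:E =
           \int[P]_y \int[P]_x (F (x, y))%:E)%E.
  by apply: eq_integral => y _; rewrite fineK//; exact: integrable_fin_num (sec' y).
by move=> /= ->.
Qed.

End BorelContinuous.

Section CContinuous.
Context (R : realType).

(* [ccontinuous] asks for a pointed space, which [G * G] is not known to be. *)
Definition ccont (G : topologicalType) (f : G -> R[i]) :=
  continuous (fun x => Re (f x)) /\ continuous (fun x => Im (f x)).

Lemma ccontinuous_comp (G H : topologicalType) (f : H -> R[i]) (m : G -> H) :
  ccont f -> continuous m -> ccont (fun x => f (m x)).
Proof.
move=> [f1 f2] cm; split=> x.
  exact: (@continuous_comp _ _ _ m (fun y => Re (f y)) x (cm x) (f1 (m x))).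
exact: (@continuous_comp _ _ _ m (fun y => Im (f y)) x (cm x) (f2 (m x))).
Qed.

Variable G : topologicalType.
Implicit Types f g : G -> R[i].

Lemma ccontinuousD f g : ccont f -> ccont g ->
  ccont (fun x => f x + g x).
Proof.
move=> [f1 f2] [g1 g2]; split => x.
  by under eq_fun do rewrite cReD; apply: cvgD; [exact: f1|exact: g1].
by under eq_fun do rewrite cImD; apply: cvgD; [exact: f2|exact: g2].
Qed.

Lemma ccontinuousM f g : ccont f -> ccont g ->
  ccont (fun x => f x * g x).
Proof.
move=> [f1 f2] [g1 g2]; split => x.
  under eq_fun do rewrite cReM.
  by apply: cvgB; apply: cvgM; [exact: f1|exact: g1|exact: f2|exact: g2].
under eq_fun do rewrite cImM.
by apply: cvgD; apply: cvgM; [exact: f1|exact: g2|exact: f2|exact: g1].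
Qed.

Lemma ccontinuous_cst c : ccont (fun _ : G => c : R[i]).
Proof. by split; exact: cst_continuous. Qed.

Lemma ccontinuousN f : ccont f -> ccont (fun x => - f x).
Proof.
move=> cf; under eq_fun do rewrite -mulN1r.
by apply: ccontinuousM => //; exact: ccontinuous_cst.
Qed.

Lemma ccontinuousJ f : ccont f -> ccont (fun x => (f x)^*).
Proof.
move=> [f1 f2]; split => x; first by under eq_fun do rewrite cReJ; exact: f1.
by under eq_fun do rewrite cImJ; apply: cvgN; exact: f2.
Qed.

Lemma ccontinuous_sum I (r : seq I) (F : I -> G -> R[i]) :
  (forall i, ccont (F i)) -> ccont (fun x => \sum_(i <- r) F i x).
Proof.
move=> cF; elim: r => [|i r ih].
  by under eq_fun do rewrite big_nil; exact: ccontinuous_cst.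
by under eq_fun do rewrite big_cons; exact: ccontinuousD.
Qed.

End CContinuous.

Lemma ccontinuous_cmeasurable (R : realType) (G : ptopologicalType)
  (f : G -> R[i]) : ccont f -> cmeasurable (f : borelT G -> R[i]).
Proof. by move=> [f1 f2]; split; exact: continuous_borel. Qed.

(** * Convolution on a compact group *)

Section CompactGroup.
Context (R : realType) (G : ptopologicalType).
Variables (mul : G -> G -> G) (inv : G -> G) (one : G).
Variable mu : {measure set (borelT G) -> \bar R}.
Hypothesis hG : compact_group mul inv one.
Hypothesis hmu : haar_probability mul mu.

Let mulA x y z : mul x (mul y z) = mul (mul x y) z.
Proof. by case: hG => -[]. Qed.
Let mul1g x : mul one x = x.
Proof. by case: hG => -[]. Qed.
Let mulVg x : mul (inv x) x = one.
Proof. by case: hG => -[]. Qed.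

Lemma grp_mulVK x y : mul (inv x) (mul x y) = y.
Proof. by rewrite mulA mulVg mul1g. Qed.

(** Only left unit and left inverses are assumed; multiplying on the left by [inv (inv x)] and then
    [inv x] gives the right inverse. *)
Lemma grp_mulgV x : mul x (inv x) = one.
Proof. by rewrite -[LHS](grp_mulVK (inv x)) (mulA (inv x)) mulVg mul1g mulVg. Qed.

Lemma grp_mulg1 x : mul x one = x.
Proof. by rewrite -(mulVg x) mulA grp_mulgV mul1g. Qed.

Lemma grp_mulKV x y : mul x (mul (inv x) y) = y.
Proof. by rewrite mulA grp_mulgV mul1g. Qed.

Lemma grp_invK x : inv (inv x) = x.
Proof. by rewrite -[LHS]grp_mulg1 -(mulVg x) grp_mulVK. Qed.

Lemma grp_invM x y : inv (mul x y) = mul (inv y) (inv x).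
Proof.
rewrite -[RHS](grp_mulVK (mul x y)) -(mulA x) grp_mulKV grp_mulgV.
by rewrite grp_mulg1.
Qed.

Lemma grp_inv1 : inv one = one.
Proof. by rewrite -[LHS]grp_mulg1 mulVg. Qed.

Lemma grp_compact : compact [set: G]. Proof. by case: hG => _ []. Qed.
Lemma grp_second_countable : @second_countable G. Proof. by case: hG => _ []. Qed.

Lemma haar_total : mu setT = 1%E. Proof. by case: hmu. Qed.

Lemma continuous_mul2 (H : topologicalType) (a b : H -> G) :
  continuous a -> continuous b -> continuous (fun x => mul (a x) (b x)).
Proof.
move=> ca cb x; case: hG => _ [cm _ _ _ _].
apply: (@cvg_comp _ _ _ (fun x => (a x, b x)) (fun p => mul p.1 p.2) _
  (nbhs (a x, b x))); last exact: (cm (a x, b x)).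
by apply: cvg_pair; [exact: ca|exact: cb].
Qed.

Lemma continuous_inv2 (H : topologicalType) (a : H -> G) :
  continuous a -> continuous (fun x => inv (a x)).
Proof.
move=> ca x; case: hG => _ [_ ci _ _ _].
exact: (@continuous_comp _ _ _ a inv x (ca x) (ci (a x))).
Qed.

Lemma continuous_mull a : continuous (mul a).
Proof. by apply: continuous_mul2 => [x|x]; [exact: cvg_cst|exact: cvg_id]. Qed.

Lemma continuous_quot : continuous (fun p : G * G => mul (inv p.2) p.1).
Proof.
apply: continuous_mul2; last by move=> x; exact: cvg_fst.
by apply: continuous_inv2 => x; exact: cvg_snd.
Qed.

Lemma continuous_quot1 g : continuous (fun h => mul (inv h) g).
Proof.
apply: continuous_mul2; last by move=> x; exact: cvg_cst.
by apply: continuous_inv2 => x; exact: cvg_id.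
Qed.

Lemma continuous_pair1 (a : G) : continuous (fun y : G => (a, y)).
Proof. by move=> y; apply: cvg_pair; [exact: cvg_cst|exact: cvg_id]. Qed.

Lemma continuous_fstG : continuous (fst : G * G -> G).
Proof. by move=> x; exact: cvg_fst. Qed.

Lemma continuous_sndG : continuous (snd : G * G -> G).
Proof. by move=> x; exact: cvg_snd. Qed.

Lemma measurable_mull a : measurable_fun setT (mul a : borelT G -> borelT G).
Proof.
have := @measurability _ _ (borelT G) (borelT G) setT (mul a) (@open G) erefl.
apply => _ [A oA <-].
rewrite setTI.
apply: measurable_open; apply: open_comp => // x _; exact: continuous_mull.
Qed.

(** Invariance is assumed for images; the preimage under a translation is the image under the
    inverse one. *)
Lemma haar_preimage a (A : set (borelT G)) : measurable A ->
  mu (mul a @^-1` A) = mu A.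
Proof.
move=> mA; case: hmu => _ /(_ (inv a) _ mA) <-; congr (mu _).
apply/seteqP; split=> [x /= Ax|_ [x Ax <-]]; last by rewrite /= grp_mulKV.
by exists (mul a x) => //; rewrite grp_mulVK.
Qed.

Lemma sqnorm_mull a (f : G -> R[i]) : cmeasurable (f : borelT G -> R[i]) ->
  sqnorm mu (fun x => f (mul a x)) = sqnorm mu f.
Proof.
move=> mf; rewrite /sqnorm.
have m : measurable_fun setT (fun y : borelT G => (sqmod (f y))%:E).
  by apply/measurable_EFinP; exact: measurable_sqmod.
have p : {in [set: borelT G], forall y, (0 <= (sqmod (f y))%:E)%E}.
  by move=> y _; rewrite lee_fin sqmod_ge0.
have := ge0_integral_pushforward (measurable_mull a) mu measurableT m p.
rewrite preimage_setT => e; rewrite -[LHS]e.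
apply: eq_measure_integral => [|? A mA _]; first exact: measurable_mull.
exact: haar_preimage.
Qed.

Lemma Rintegral_mull a (f : G -> R) : continuous f ->
  \int[mu]_x f (mul a x) = \int[mu]_x f x.
Proof.
move=> cf; rewrite /Rintegral; congr fine.
have m : measurable_fun setT (fun y : borelT G => (f y)%:E).
  by apply/measurable_EFinP; exact: continuous_borel.
have im : mu.-integrable (mul a @^-1` setT) ((fun y : borelT G => (f y)%:E) \o mul a).
  rewrite preimage_setT; apply: (@continuous_integrable _ _ _ (f \o mul a)).
  + exact: grp_compact.
  + by rewrite haar_total ltry.
  + by move=> x; exact: (continuous_comp (@continuous_mull a x) (cf _)).
have := integral_pushforward (measurable_mull a) m im measurableT.
rewrite preimage_setT => e; rewrite -[LHS]e.
apply: eq_measure_integral => [|? A mA _]; first exact: measurable_mull.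
exact: haar_preimage.
Qed.

Lemma ccontinuous_integrable (f : G -> R[i]) : ccont f ->
  cintegrable mu (f : borelT G -> R[i]).
Proof.
by move=> [f1 f2]; split; apply: continuous_integrable => //;
  rewrite ?haar_total ?ltry//; exact: grp_compact.
Qed.

Lemma cintegral_mull a (f : G -> R[i]) : ccont f ->
  cintegral mu (fun x => f (mul a x)) = cintegral mu f.
Proof.
move=> [f1 f2]; apply: complexP => /=.
  exact: (@Rintegral_mull a (fun x => Re (f x))).
exact: (@Rintegral_mull a (fun x => Im (f x))).
Qed.

Lemma ccontinuous_cintegral (F : G * G -> R[i]) : ccont F ->
  ccont (fun x : G => cintegral mu (fun y => F (x, y))).
Proof.
move=> [F1 F2]; split.
  exact: (continuous_Rintegral grp_compact haar_total F1).
exact: (continuous_Rintegral grp_compact haar_total F2).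
Qed.

Lemma cintegral_swap (F : G * G -> R[i]) : ccont F ->
  cintegral mu (fun x => cintegral mu (fun y => F (x, y))) =
  cintegral mu (fun y => cintegral mu (fun x => F (x, y))).
Proof.
move=> [F1 F2]; apply: complexP => /=.
  exact: (Rintegral_swap grp_compact grp_second_countable haar_total F1).
exact: (Rintegral_swap grp_compact grp_second_countable haar_total F2).
Qed.

Lemma cintegral_sum I (r : seq I) (F : I -> G -> R[i]) :
  (forall i, ccont (F i)) ->
  cintegral mu (fun x => \sum_(i <- r) F i x) = \sum_(i <- r) cintegral mu (F i).
Proof.
move=> cF; elim: r => [|i r ih].
  rewrite big_nil; under eq_cintegral do rewrite big_nil.
  by apply: complexP; rewrite /= Rintegral_cst//= mul0r.
rewrite big_cons; under eq_cintegral do rewrite big_cons.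
rewrite cintegralD ?ih//; apply: ccontinuous_integrable => //.
exact: ccontinuous_sum.
Qed.

Lemma cintegral_cst c : cintegral mu (fun _ => c) = c.
Proof.
by apply: complexP; rewrite /= Rintegral_cst// [X in fine X]haar_total mulr1.
Qed.

Lemma Re_cintegral_ge0 (F : G -> R[i]) : (forall x, 0 <= Re (F x)) ->
  0 <= Re (cintegral mu F).
Proof. by move=> F0; apply: Rintegral_ge0 => x _. Qed.

Local Notation conv := (convolution mul inv mu).

Implicit Types a b c : G -> R[i].

Lemma ccontinuous_conv_kernel a b : ccont a -> ccont b ->
  ccont (fun p : G * G => a p.2 * b (mul (inv p.2) p.1)).
Proof.
move=> ca cb; apply: ccontinuousM.
  exact: (ccontinuous_comp ca continuous_sndG).
exact: (ccontinuous_comp cb continuous_quot).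
Qed.

Lemma ccontinuous_conv_kernel1 a b g : ccont a -> ccont b ->
  ccont (fun h : G => a h * b (mul (inv h) g)).
Proof.
move=> ca cb.
exact: (ccontinuous_comp (ccontinuous_conv_kernel ca cb) (@continuous_pair1 g)).
Qed.

Lemma ccontinuous_conv a b : ccont a -> ccont b ->
  ccont (conv a b).
Proof.
move=> ca cb; exact: (ccontinuous_cintegral (ccontinuous_conv_kernel ca cb)).
Qed.

Lemma convolDr a b c : ccont a -> ccont b -> ccont c ->
  conv a (fun x => b x + c x) = fun g => conv a b g + conv a c g.
Proof.
move=> ca cb cc; apply/funext => g; rewrite /convolution.
under [LHS]eq_cintegral do rewrite mulrDr.
by rewrite cintegralD//; apply: ccontinuous_integrable;
  exact: ccontinuous_conv_kernel1.
Qed.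

Lemma convolZr k a b : ccont a -> ccont b ->
  conv a (fun x => k * b x) = fun g => k * conv a b g.
Proof.
move=> ca cb; apply/funext => g; rewrite /convolution.
under [LHS]eq_cintegral do rewrite mulrCA.
by rewrite cintegralZ//; apply: ccontinuous_integrable;
  exact: ccontinuous_conv_kernel1.
Qed.

Lemma convolA a b c : ccont a -> ccont b -> ccont c ->
  conv (conv a b) c = conv a (conv b c).
Proof.
move=> ca cb cc; apply/funext => g; rewrite {1 3}/convolution.
pose F (p : G * G) := a p.2 * b (mul (inv p.2) p.1) * c (mul (inv p.1) g).
have cF : ccont F.
  apply: ccontinuousM; first exact: ccontinuous_conv_kernel.
  apply: (ccontinuous_comp cc) => p.
  exact: (continuous_comp (@continuous_fstG p) (@continuous_quot1 g _)).
transitivity (cintegral mu (fun h => cintegral mu (fun k => F (h, k)))).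
  apply: eq_cintegral => h; rewrite mulrC -cintegralZ.
    by apply: eq_cintegral => k; rewrite mulrC.
  by apply: ccontinuous_integrable; exact: ccontinuous_conv_kernel1.
rewrite cintegral_swap//; apply: eq_cintegral => k.
(* Left invariance substitutes [mul (inv k) h] for the variable of the inner convolution, which
   makes its integrand the one left by the exchange of integrals. *)
rewrite [conv b c _](_ : _ = cintegral mu (fun h => b (mul (inv k) h) *
    c (mul (inv (mul (inv k) h)) (mul (inv k) g)))); last first.
  have cbc := ccontinuous_conv_kernel1 (mul (inv k) g) cb cc.
  exact/esym/(cintegral_mull (inv k) cbc).
rewrite -cintegralZ; last first.
  apply: ccontinuous_integrable.
  apply: (ccontinuous_comp (ccontinuous_conv_kernel1 (mul (inv k) g) cb cc)).
  exact: continuous_mull.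
apply: eq_cintegral => h; rewrite /F /= -mulrA; congr (_ * (_ * c _)).
by rewrite grp_invM grp_invK -mulA grp_mulKV.
Qed.

(** Translating the variable by [inv g] turns the argument of [b] into [inv h] and that of [a] into
    [mul (inv g) h], so left invariance alone is enough. *)
Lemma fcheck_conv a b : ccont a -> ccont b ->
  fcheck inv (conv a b) = conv (fcheck inv b) (fcheck inv a).
Proof.
move=> ca cb; apply/funext => g; rewrite {1}/fcheck /convolution.
rewrite -cintegralJ; last first.
  by apply: ccontinuous_integrable; exact: ccontinuous_conv_kernel1.
have cJ : ccont (fun h => (a h * b (mul (inv h) (inv g)))^*).
  by apply: ccontinuousJ; exact: ccontinuous_conv_kernel1.
rewrite -(@cintegral_mull (inv g) _ cJ); apply: eq_cintegral => h.
rewrite rmorphM /= mulrC /fcheck !grp_invM !grp_invK.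
by rewrite -mulA grp_mulgV grp_mulg1.
Qed.

(** Translating the variable by [k1] moves [k1] into [a], which absorbs it; [k2] is absorbed by
    [b]. *)
Lemma biK_conv (K : set G) a b : closed_subgroup mul inv one K ->
  ccont a -> ccont b ->
  biK_invariant mul K a -> biK_invariant mul K b -> biK_invariant mul K (conv a b).
Proof.
move=> [_ K1 _ _] ca cb Ka Kb g k1 k2 K1k K2k; rewrite /convolution.
rewrite -(@cintegral_mull k1); last exact: ccontinuous_conv_kernel1.
apply: eq_cintegral => h.
have -> : a (mul k1 h) = a h by rewrite -[RHS](Ka h k1 one)// grp_mulg1.
congr (_ * _); rewrite grp_invM -mulA -(mulA k1) grp_mulVK.
by rewrite -[RHS](Kb (mul (inv h) g) one k2)// mul1g mulA.
Qed.

End CompactGroup.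

(** * Positive definite functions *)

Section FullSupport.
Context (R : realType) (G : ptopologicalType).
Variables (mul : G -> G -> G) (inv : G -> G) (one : G).
Variable mu : {measure set (borelT G) -> \bar R}.
Hypothesis hG : compact_group mul inv one.
Hypothesis hmu : haar_probability mul mu.

(** By compactness finitely many translates of [U] cover the group; if [U] were null, so would be
    the whole group. *)
Lemma haar_open_gt0 (U : set G) : open U -> U !=set0 -> (0 < mu U)%E.
Proof.
move=> oU [u Uu]; rewrite lt0e measure_ge0 andbT; apply/eqP => U0.
have := grp_compact hG; rewrite compact_cover.
move=> /(_ G setT (fun a => mul a @^-1` U)).
case=> [a _||D _ Dcov].
- by apply: open_comp => // x _; exact: (continuous_mull hG).
- move=> x _; exists (mul u (inv x)) => //=; case: (hG) => -[mulA mul1g mulVg] _.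
  by rewrite -mulA mulVg (grp_mulg1 hG).
have : mu.-negligible (cover [set` D] (fun a => mul a @^-1` U) : set (borelT G)).
  rewrite /cover bigcup_fset; elim/big_ind: _ => //.
  - exact: negligible_set0.
  - by move=> A B; exact: negligibleU.
  move=> a _; have mU := measurable_open oU.
  exists (mul a @^-1` U); split => //; last by rewrite (haar_preimage hG hmu).
  apply: measurable_open; apply: open_comp => // x _.
  exact: (continuous_mull hG).
move=> [N [mN N0 covN]].
have : (mu setT <= mu N)%E.
  apply: le_measure; [exact/mem_set/measurableT|exact/mem_set|].
  by move=> x /Dcov; exact: covN.
by rewrite N0 (haar_total hmu) lee_fin ler10.
Qed.

(** If [w] were nonzero at a point, some [v N1] would be large on a neighbourhood of it, hence so
    would all later [v n], uniformly. That neighbourhood has positive measure, so the integrals of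
    the squares could not tend to 0. It is defined through [v N1], as [w] is not assumed
    continuous. *)
Lemma uniform_L2_limit_eq0 (v : nat -> G -> R) (w : G -> R) :
  (forall n, continuous (v n)) ->
  (forall e, 0 < e -> exists N, forall n, (N <= n)%N -> forall g, `|w g - v n g| <= e) ->
  (forall e, 0 < e -> exists N, forall n, (N <= n)%N ->
    (\int[mu]_x ((v n x) ^+ 2)%:E <= e%:E)%E) ->
  forall g, w g = 0.
Proof.
move=> cv vw v0 g0; apply/eqP; apply: contraT => wg0.
(* At [g0], [|v N1|] is at least [7 e], so [g0] lies in the set where it exceeds [3 e]. There a
   later [v n], within [2 e] of [v N1], still has modulus at least [e]. *)
pose e := `|w g0| / 8.
have e0 : 0 < e by rewrite divr_gt0// normr_gt0.
have e8 : `|w g0| = 8 * e by rewrite /e; field.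
have [N1 hN1] := vw e e0.
pose U := [set x | 3 * e < `|v N1 x|].
have oU : open U.
  apply: open_preimage_gt => x; apply: (@continuous_comp _ _ _ (v N1) (@Num.norm _ R) x).
    exact: cv.
  exact: norm_continuous.
have Ug0 : U g0.
  have := hN1 _ (leqnn _) g0; have := ler_normD (w g0 - v N1 g0) (v N1 g0).
  by rewrite subrK e8 /U /=; lra.
have mU : measurable (U : set (borelT G)) := measurable_open oU.
have U0 := haar_open_gt0 oU (ex_intro _ _ Ug0).
have Ufin : mu U \is a fin_num.
  rewrite ge0_fin_numE//; apply: (@le_lt_trans _ _ (mu setT)).
    by apply: le_measure => //; [exact/mem_set|exact/mem_set/measurableT].
  by rewrite (haar_total hmu) ltry.
have U0' : 0 < fine (mu U) by rewrite fine_gt0// U0 -ge0_fin_numE.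
have [N2 hN2] := v0 (e ^+ 2 * fine (mu U) / 2) ltac:(by rewrite divr_gt0// mulr_gt0// exprn_gt0).
pose n := maxn N1 N2.
have vU x : U x -> e ^+ 2 <= v n x ^+ 2.
  move=> Ux; rewrite -(real_normK (num_real (v n x))) ler_pXn2r ?nnegrE ?(ltW e0)//.
  have h1 := hN1 _ (leqnn _) x; have h2 := hN1 n (leq_maxl _ _) x.
  have := ler_distD (w x) (v N1 x) (v n x).
  have := ler_normD (v N1 x - v n x) (v n x).
  by rewrite subrK; move: Ux; rewrite /U /= (distrC (v N1 x) (w x)); lra.
have mv : measurable_fun setT (fun x : borelT G => ((v n x) ^+ 2)%:E).
  apply/measurable_EFinP; apply: measurable_funX; apply: continuous_borel.
  exact: cv.
have : ((e ^+ 2)%:E * mu U <= \int[mu]_x ((v n x) ^+ 2)%:E)%E.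
  rewrite -integral_cst//.
  apply: (@le_trans _ _ (\int[mu]_(x in U) ((v n x) ^+ 2)%:E)%E).
    apply: ge0_le_integral => //.
    - by move=> x _; rewrite lee_fin sqr_ge0.
    - exact: measurable_funTS.
  apply: ge0_subset_integral => //.
  by move=> x _; rewrite lee_fin sqr_ge0.
move=> /le_trans/(_ (hN2 n (leq_maxr _ _))).
rewrite -(fineK Ufin) -EFinM lee_fin /=.
have : 0 < e ^+ 2 * fine (mu U) by rewrite mulr_gt0// exprn_gt0.
by lra.
Qed.

End FullSupport.

Section PositiveDefinite.
Context (R : realType) (G : ptopologicalType).
Variables (mul : G -> G -> G) (inv : G -> G) (one : G).
Variable mu : {measure set (borelT G) -> \bar R}.
Hypothesis hG : compact_group mul inv one.
Hypothesis hmu : haar_probability mul mu.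
Variable phi : G -> R[i].
Hypothesis cphi : ccont phi.
Hypothesis pphi : positive_definite mul inv phi.

Local Notation conv := (convolution mul inv mu).

Let mulA x y z : mul x (mul y z) = mul (mul x y) z.
Proof. by case: hG => -[]. Qed.
Let mul1g x : mul one x = x.
Proof. by case: hG => -[]. Qed.
Let mulVg x : mul (inv x) x = one.
Proof. by case: hG => -[]. Qed.

(** Lists of weighted points, rather than families over ['I_m], allow points to be added one at a
    time. The weights are the conjugates of the [xi], which matches the order of factors in
    [convolution]. *)
Definition pd_form (s : seq (G * R[i])) : R[i] :=
  \sum_(p <- s) \sum_(q <- s) phi (mul (inv p.1) q.1) * p.2 * q.2^*.

Lemma pd_form_ge0 s : 0 <= pd_form s.
Proof.
have := pphi (fun i => (tnth (in_tuple s) i).1)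
             (fun i => ((tnth (in_tuple s) i).2)^*).
congr (0 <= _); rewrite /pd_form [RHS]big_tnth; apply: eq_bigr => i _.
rewrite [RHS]big_tnth; apply: eq_bigr => j _.
by congr (_ * _ * _); exact: conjcK.
Qed.

Lemma pd_one_ge0 : 0 <= phi one.
Proof.
have := pd_form_ge0 [:: (one, 1)].
by rewrite /pd_form !big_seq1 /= mulVg rmorph1 !mulr1.
Qed.

(** Nonnegativity in [R[i]] includes vanishing of the imaginary part. At the points [one] and [g],
    the weights [1, 1] and [1, 'i] give one linear equation for each part. *)
Lemma pd_hermitian g : phi (inv g) = (phi g)^*.
Proof.
have hI := grp_inv1 hG.
have i0 : Im (phi one) = 0 by exact: (ger0_Im pd_one_ge0).
have := ger0_Im (pd_form_ge0 [:: (one, 1); (g, 1)]).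
have := ger0_Im (pd_form_ge0 [:: (one, 1); (g, 'i)]).
rewrite /pd_form !big_cons !big_nil /= !addr0 !mulVg !hI !mul1g !(grp_mulg1 hG).
move: i0; case: (phi g) => a b; case: (phi (inv g)) => p q; case: (phi one) => c d /=.
move=> dE; rewrite dE => h1 h2; congr (_ +i* _); lra.
Qed.

(** The two families of cross terms are conjugate because [phi] is Hermitian, so under [Re] they
    merge into the factor 2. *)
Lemma pd_form_cons x a s :
  Re (pd_form ((x, a) :: s)) = Re (phi one * (a * a^*)
    + 2 * \sum_(q <- s) phi (mul (inv x) q.1) * a * q.2^* + pd_form s).
Proof.
rewrite /pd_form big_cons big_cons /= mulVg.
under [X in _ + X]eq_bigr do rewrite big_cons /=.
rewrite big_split /= [in LHS]cReD [in LHS]cReD [in LHS](cReD (\sum_(i <- s) _)).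
rewrite [Re (\sum_(i <- s) phi (mul (inv i.1) x) * i.2 * a^*)](_ : _ =
  Re (\sum_(q <- s) phi (mul (inv x) q.1) * a * q.2^*)).
  by rewrite [in RHS]cReD [in RHS]cReD mulr_natl mulr2n cReD mulrA; lra.
rewrite !Re_sum; apply: eq_bigr => q _.
rewrite -[in LHS](grp_invK hG x) -(grp_invM hG) pd_hermitian.
by rewrite !ReImE /=; ring.
Qed.

(** This is the form on the weights [a] at [x] and [- b] at [y]. *)
Lemma pd_two_points x y a b :
  2 * Re (phi (mul (inv x) y) * a * b^*) <= Re (phi one * (a * a^* + b * b^*)).
Proof.
have := pd_form_ge0 [:: (x, a); (y, - b)]; rewrite lecE => /andP[_].
rewrite pd_form_cons big_seq1 /pd_form !big_seq1 /= mulVg rmorphN /=.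
rewrite (_ : phi one * - b * - b^* = phi one * (b * b^*)); last by ring.
by rewrite mulrN mulrN mulrDr !cReD cReN cRe_natl; lra.
Qed.

(** * From finite sums to integrals by random sampling *)

Section MonteCarlo.
Variable u : G -> R[i].
Hypothesis cu : ccont u.

Let S := cintegral mu (fun x => u x * (u x)^*).
Let I := cintegral mu (fun x => conv u phi x * (u x)^*).
Let L (s : seq (G * R[i])) := \sum_(q <- s) conv u phi q.1 * q.2^*.

Let cuu : ccont (fun x => u x * (u x)^*).
Proof. by apply: ccontinuousM => //; exact: ccontinuousJ. Qed.

Let cconv : ccont (fun x => conv u phi x * (u x)^*).
Proof.
apply: ccontinuousM; last exact: ccontinuousJ.
exact: (ccontinuous_conv hG hmu).
Qed.

(* Expected value of the form on [s] together with [N] random Haar distributed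
   points [x] carrying the weights [u x]; the induction draws one point at a
   time, so that only single integrals of continuous functions occur. *)
Let monte_carlo N s : 0 <= Re (pd_form s + 2 * N%:R * L s
   + N%:R * (phi one * S) + N%:R * (N%:R - 1) * I).
Proof.
elim: N s => [|N ih] s.
  rewrite mulr0 !mul0r !addr0.
  by have := pd_form_ge0 s; rewrite lecE => /andP[_].
pose C := pd_form s + 2 * N%:R * L s + N%:R * (phi one * S) + N%:R * (N%:R - 1) * I.
(* Up to its imaginary part, [H x] is the quantity for [N] random points with [(x, u x)] added to
   the list. Its integral is the quantity for [N + 1] points: the coefficient of [I] grows by [2 N],
   from [N (N - 1)] to [(N + 1) N]. *)
pose H x := C + (phi one * (u x * (u x)^*)
  + (2 * (\sum_(q <- s) phi (mul (inv x) q.1) * u x * q.2^*)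
     + 2 * N%:R * (conv u phi x * (u x)^*))).
have H0 x : 0 <= Re (H x).
  have := ih ((x, u x) :: s); rewrite /L big_cons /= -/(L s).
  have := pd_form_cons x (u x) s.
  set K := \sum_(q <- s) _; set Q := pd_form (_ :: _); set W := conv u phi x * _ => hQ.
  congr (0 <= _); rewrite /H /C mulrDr !cReD hQ !cReD; lra.
have := Re_cintegral_ge0 mu H0.
have cK q : ccont (fun x => phi (mul (inv x) q.1) * u x * q.2^*).
  apply: ccontinuousM; last exact: ccontinuous_cst.
  apply: ccontinuousM => //.
  exact: (ccontinuous_comp cphi (@continuous_quot1 _ _ _ _ hG q.1)).
have ci := @ccontinuous_integrable _ _ _ _ _ mu hG hmu.
have cZ (c : R[i]) f : ccont f -> ccont (fun x : G => c * f x).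
  by move=> cf; apply: ccontinuousM => //; exact: ccontinuous_cst.
have cs : ccont (fun x => \sum_(q <- s) phi (mul (inv x) q.1) * u x * q.2^*).
  exact: ccontinuous_sum.
have c1 := cZ 2 _ cs; have c2 := cZ (2 * N%:R) _ cconv.
have c3 := ccontinuousD c1 c2; have c4 := cZ (phi one) _ cuu.
have c5 := ccontinuousD c4 c3.
rewrite /H cintegralD ?(cintegral_cst hmu); [|exact/ci/ccontinuous_cst|exact: ci].
rewrite cintegralD; [|exact: ci|exact: ci].
rewrite cintegralD; [|exact: ci|exact: ci].
rewrite !cintegralZ; [|exact: ci|exact: ci|exact: ci].
rewrite (cintegral_sum hG hmu)// -/S -/I.
have -> : \sum_(q <- s) cintegral mu (fun x => phi (mul (inv x) q.1) * u x * q.2^*)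
    = L s.
  apply: eq_bigr => q _; rewrite mulrC -cintegralZ.
    by apply: eq_cintegral => x; rewrite mulrC (mulrC (u x)).
  by apply: ci; exact: (ccontinuous_conv_kernel1 hG).
congr (0 <= Re _); rewrite /C -[N.+1]addn1 natrD; ring.
Qed.

(* The form evaluated on the measure [delta_1 - u(x) dx]. *)
Lemma pd_dirac_sub : 0 <= Re (phi one - 2 * conv u phi one + I).
Proof.
(* This extracts the leading coefficient in [N], which replaces dividing by [N^2] and passing to the
   limit. *)
have key (x y : R) : (forall N : nat, 0 <= N%:R * (N%:R * x + y)) -> 0 <= x.
  move=> h; rewrite leNgt; apply/negP => x0.
  pose N := (Num.truncn (`|y| / - x)).+1.
  have := h N; rewrite pmulr_rge0 ?ltr0n// leNgt => /negP; apply.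
  have : `|y| / - x < N%:R by exact: truncnS_gt.
  rewrite ltr_pdivrMr ?oppr_gt0// => hy; have := ler_norm y; lra.
apply: (key _ (Re (phi one * S - I))) => N.
(* The weight [- N] at [one] balances [N] random points: the terms of order [N^2] form the claimed
   quantity, and the diagonal leaves only [N (phi one * S - I)]. *)
have := monte_carlo N [:: (one, - N%:R)].
rewrite /L /pd_form !big_seq1 /= mulVg rmorphN rmorph_nat.
suff <- : Re (N%:R * (N%:R * (phi one - 2 * conv u phi one + I) + (phi one * S - I)))
  = N%:R * (N%:R * Re (phi one - 2 * conv u phi one + I) + Re (phi one * S - I)).
  by congr (0 <= Re _); ring.
by rewrite [LHS]cRe_natl [in LHS]cReD; congr (_ * (_ + _)); exact: cRe_natl.
Qed.

(** Integrate [pd_two_points] over both points, with the values of [u] as weights. As quadratic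
    forms, convolution by [phi] is thus at most [phi one] times the identity. *)
Lemma pd_form_le : Re I <= Re (phi one * S).
Proof.
pose F x h := phi one * (u h * (u h)^* + u x * (u x)^*)
  + - 2 * (u x)^* * (u h * phi (mul (inv h) x)).
have F0 x h : 0 <= Re (F x h).
  have := pd_two_points h x (u h) (u x).
  rewrite /F cReD [X in _ -> 0 <= _ + Re X](_ : _ =
   - (phi (mul (inv h) x) * u h * (u x)^* + phi (mul (inv h) x) * u h * (u x)^*)).
    by rewrite cReN cReD; lra.
  by ring.
have ci := @ccontinuous_integrable _ _ _ _ _ mu hG hmu.
have cZ (c : R[i]) f : ccont f -> ccont (fun x : G => c * f x).
  by move=> cf; apply: ccontinuousM => //; exact: ccontinuous_cst.
have G0 x : 0 <= Re (phi one * (S + u x * (u x)^*) + - 2 * (conv u phi x * (u x)^*)).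
  have := Re_cintegral_ge0 mu (F0 x); rewrite /F.
  have ck := ccontinuous_conv_kernel1 hG x cu cphi.
  have cc1 := @ccontinuous_cst R G (u x * (u x)^*).
  have c2 := ccontinuousD cuu cc1.
  rewrite cintegralD; [|exact/ci/cZ|exact/ci/cZ].
  rewrite !cintegralZ; [|exact/ci|exact/ci].
  rewrite cintegralD ?(cintegral_cst hmu); [|exact/ci|exact/ci].
  by rewrite -/(conv u phi x) -/S -mulrA (mulrC (u x)^* (conv _ _ _)).
have := Re_cintegral_ge0 mu G0.
have c2 := ccontinuousD (@ccontinuous_cst R G S) cuu.
rewrite cintegralD; [|exact/ci/cZ|exact/ci/cZ].
rewrite !cintegralZ; [|exact/ci|exact/ci].
rewrite cintegralD ?(cintegral_cst hmu); [|exact/ci/ccontinuous_cst|exact/ci].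
rewrite -/S -/I mulNr mulr_natl mulrDr cReD cReN mulr2n !cReD; lra.
Qed.

End MonteCarlo.

End PositiveDefinite.

(** * The square root iteration *)

Section SquareRootPolynomials.
Variable R : realType.

Local Notation h := ((2^-1)%:P : {poly R}).

(** ['X] stands for [1 - s]. For an iterate [p = s P], the step to [p + (s - p^2) / 2] is [s] times
    the step to [P + (1 - s P^2) / 2]. *)
Fixpoint sqrt_poly (n : nat) : {poly R} :=
  if n is n'.+1 then sqrt_poly n' + h * (1 - (1 - 'X) * sqrt_poly n' ^+ 2) else 0.

Definition sqrt_incr n := h * (1 - (1 - 'X) * sqrt_poly n ^+ 2).
Definition sqrt_rem n := 1 - (1 - 'X) * sqrt_poly n.

Lemma halfpolyD : h + h = 1.
Proof. by rewrite -polyCD; congr (_%:P); field. Qed.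

(** In terms of the iterate [p = s P], the remainder is [1 - p], and [1 - p - (s - p^2) / 2 = ((1 -
    s) + (1 - p)^2) / 2]. This form makes the signs of the coefficients visible. *)
Lemma sqrt_remS n : sqrt_rem n.+1 = h * ('X + sqrt_rem n ^+ 2).
Proof.
rewrite /sqrt_rem /=; set P := sqrt_poly n.
apply/eqP; rewrite -subr_eq0; apply/eqP.
(* The identity rests on [h + h = 1], so the difference of its sides is exhibited as a multiple of
   [1 - (h + h)]. *)
transitivity ((1 - (h + h)) * (1 - (1 - 'X) * P)); first by ring.
by rewrite halfpolyD subrr mul0r.
Qed.

(** With [d = P' - P] the current increment, the next one is [d - h s (P'^2 - P^2) = d (1 - h s (P +
    P'))], and the last factor is [h] times the sum of the two remainders. *)
Lemma sqrt_incrS n :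
  sqrt_incr n.+1 = sqrt_incr n * h * (sqrt_rem n + sqrt_rem n.+1).
Proof.
rewrite /sqrt_incr /sqrt_rem /=; set P := sqrt_poly n.
apply/eqP; rewrite -subr_eq0; apply/eqP.
transitivity ((1 - (h + h)) * (h * (1 - (1 - 'X) * P ^+ 2))); first by ring.
by rewrite halfpolyD subrr mul0r.
Qed.

Definition coef_ge0 (P : {poly R}) := forall i, 0 <= P`_i.

Lemma coef_ge0D P Q : coef_ge0 P -> coef_ge0 Q -> coef_ge0 (P + Q).
Proof. by move=> p q i; rewrite coefD addr_ge0. Qed.

Lemma coef_ge0M P Q : coef_ge0 P -> coef_ge0 Q -> coef_ge0 (P * Q).
Proof. by move=> p q i; rewrite coefM sumr_ge0// => j _; rewrite mulr_ge0. Qed.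

Lemma coef_ge0C c : 0 <= c -> coef_ge0 c%:P.
Proof. by move=> c0 i; rewrite coefC; case: ifP. Qed.

Lemma coef_ge0X : coef_ge0 'X.
Proof. by move=> i; rewrite coefX ler0n. Qed.

Lemma half_nneg : coef_ge0 h.
Proof. by apply: coef_ge0C; rewrite invr_ge0. Qed.

Lemma sqrt_rem_nneg n : coef_ge0 (sqrt_rem n).
Proof.
elim: n => [|n ih].
  by rewrite /sqrt_rem /= mulr0 subr0; apply: coef_ge0C.
rewrite sqrt_remS expr2; apply: coef_ge0M; first exact: half_nneg.
by apply: coef_ge0D; [exact: coef_ge0X|exact: coef_ge0M].
Qed.

Lemma sqrt_incr_nneg n : coef_ge0 (sqrt_incr n).
Proof.
elim: n => [|n ih].
  by rewrite /sqrt_incr /= expr0n mulr0 subr0 mulr1; exact: half_nneg.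
rewrite sqrt_incrS; apply: coef_ge0M.
  by apply: coef_ge0M => //; exact: half_nneg.
by apply: coef_ge0D; exact: sqrt_rem_nneg.
Qed.

Lemma sqrt_poly_incr_nneg m n : (m <= n)%N -> coef_ge0 (sqrt_poly n - sqrt_poly m).
Proof.
move=> /subnK <-; elim: (n - m)%N => [|k ih].
  by rewrite subrr; apply: coef_ge0C.
by rewrite addSn /= addrAC; apply: coef_ge0D => //; exact: sqrt_incr_nneg.
Qed.

Lemma sqrt_poly_nneg n : coef_ge0 (sqrt_poly n).
Proof. by rewrite -[sqrt_poly n]subr0; exact: (@sqrt_poly_incr_nneg 0). Qed.

Lemma sqrt_poly_error n : 1 - (1 - 'X) * sqrt_poly n ^+ 2 =
  2 *: (sqrt_poly n.+1 - sqrt_poly n).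
Proof.
rewrite /= addrAC subrr add0r -mul_polyC mulrA -polyCM mulfV ?pnatr_eq0//.
by rewrite mul1r.
Qed.

End SquareRootPolynomials.

(** * Polynomials in [1 - phi] in the convolution algebra, and their trace *)

Section ConvolutionPolynomials.
Context (R : realType) (G : ptopologicalType).
Variables (mul : G -> G -> G) (inv : G -> G) (one : G).
Variable mu : {measure set (borelT G) -> \bar R}.
Hypothesis hG : compact_group mul inv one.
Hypothesis hmu : haar_probability mul mu.
Variable phi : G -> R[i].
Hypothesis cphi : ccont phi.
Hypothesis pphi : positive_definite mul inv phi.

Local Notation conv := (convolution mul inv mu).

Definition conv_compl (u : G -> R[i]) g := u g - conv u phi g.

(* [conv_poly P] stands for [phi * P(1 - phi)] in the convolution algebra: it is
   the sum of the [P`_i *: x_i], where [x_i] is obtained from [phi] by applying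
   [u |-> u - u * phi] [i] times. *)
Definition conv_poly (P : {poly R}) g : R[i] :=
  \sum_(i < size P) (P`_i)%:C * iter i conv_compl phi g.

Lemma conv_poly_widen n (P : {poly R}) g : (size P <= n)%N ->
  conv_poly P g = \sum_(i < n) (P`_i)%:C * iter i conv_compl phi g.
Proof.
move=> sn; rewrite /conv_poly (big_ord_widen _ (fun i => (P`_i)%:C * iter i conv_compl phi g) sn).
rewrite big_mkcond; apply: eq_bigr => i _; case: ltnP => // si.
by rewrite nth_default// mul0r.
Qed.

Lemma conv_polyD P Q g : conv_poly (P + Q) g = conv_poly P g + conv_poly Q g.
Proof.
pose n := maxn (size P) (size Q).
rewrite !(@conv_poly_widen n) ?leq_maxl ?leq_maxr ?size_polyD// -big_split /=.
by apply: eq_bigr => i _; rewrite coefD rmorphD mulrDl.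
Qed.

Lemma conv_polyZ c P g : conv_poly (c *: P) g = c%:C * conv_poly P g.
Proof.
rewrite !(@conv_poly_widen (size P)) ?size_scale_leq// mulr_sumr.
by apply: eq_bigr => i _; rewrite coefZ rmorphM mulrA.
Qed.

Lemma conv_polyN P g : conv_poly (- P) g = - conv_poly P g.
Proof. by rewrite -scaleN1r conv_polyZ rmorphN1 mulN1r. Qed.

Lemma conv_polyB P Q g : conv_poly (P - Q) g = conv_poly P g - conv_poly Q g.
Proof. by rewrite conv_polyD conv_polyN. Qed.

Lemma conv_poly0 g : conv_poly 0 g = 0.
Proof. by rewrite /conv_poly size_poly0 big_ord0. Qed.

Lemma conv_polyC c g : conv_poly c%:P g = c%:C * phi g.
Proof.
by rewrite (@conv_poly_widen 1) ?size_polyC ?leq_b1// big_ord1 coefC.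
Qed.

Lemma conv_poly1 g : conv_poly 1 g = phi g.
Proof. by rewrite conv_polyC mul1r. Qed.

Let ccZ (c : R[i]) (f : G -> R[i]) : ccont f -> ccont (fun x => c * f x).
Proof. by move=> cf; apply: ccontinuousM => //; exact: ccontinuous_cst. Qed.

Lemma ccontinuous_conv_compl u : ccont u -> ccont (conv_compl u).
Proof.
move=> cu; apply: ccontinuousD => //; apply: ccontinuousN.
exact: (ccontinuous_conv hG hmu).
Qed.

Let ccx k : ccont (iter k conv_compl phi).
Proof. by elim: k => // k; exact: ccontinuous_conv_compl. Qed.

Lemma ccontinuous_conv_poly P : ccont (conv_poly P).
Proof. by apply: ccontinuous_sum => i; exact: ccZ. Qed.

Let conv_suml I (r : seq I) (c : I -> R[i]) (x : I -> G -> R[i]) g :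
  (forall i, ccont (x i)) ->
  conv (fun y => \sum_(i <- r) c i * x i y) phi g =
  \sum_(i <- r) c i * conv (x i) phi g.
Proof.
move=> cx; rewrite {1}/convolution.
under eq_cintegral do rewrite mulr_suml.
rewrite (cintegral_sum hG hmu) => [|i].
  apply: eq_bigr => i _; under eq_cintegral do rewrite -mulrA.
  rewrite cintegralZ//; apply: (ccontinuous_integrable hG hmu).
  exact: (ccontinuous_conv_kernel1 hG).
apply: (ccontinuous_conv_kernel1 hG) => //; exact: ccZ.
Qed.

Lemma conv_polyMX P : conv_poly (P * 'X) = conv_compl (conv_poly P).
Proof.
apply/funext => g; rewrite (@conv_poly_widen (size P).+1); last first.
  by rewrite (leq_trans (size_polyMleq _ _))// size_polyX addn2.
rewrite big_ord_recl coefMX eqxx mul0r add0r /conv_compl /conv_poly conv_suml//.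
rewrite -sumrB; apply: eq_bigr => i _.
by rewrite coefMX /= mulrBr.
Qed.

(** Since ['X] stands for [1 - phi], convolution by [phi] is multiplication by [1 - 'X]. *)
Lemma conv_poly_conv_phi P :
  conv (conv_poly P) phi = conv_poly (P * (1 - 'X)).
Proof.
apply/funext => g.
by rewrite mulrBr mulr1 conv_polyB conv_polyMX /conv_compl subKr.
Qed.

Let convBr a b c : ccont a -> ccont b -> ccont c ->
  conv a (fun x => b x - c x) = fun g => conv a b g - conv a c g.
Proof.
move=> ca cb cc; rewrite (convolDr hG hmu ca cb (ccontinuousN cc)).
apply/funext => g; congr (_ + _); under [X in conv _ X]eq_fun do rewrite -mulN1r.
by rewrite (convolZr hG hmu)// mulN1r.
Qed.

Let conv0r a g : conv a (fun=> 0) g = 0.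
Proof.
rewrite /convolution; under eq_cintegral do rewrite mulr0.
by rewrite (cintegral_cst hmu).
Qed.

Let conv_poly_MXaddC P c : conv_poly (P * 'X + c%:P) =
  fun g => conv_compl (conv_poly P) g + c%:C * phi g.
Proof. by apply/funext => g; rewrite conv_polyD conv_polyMX conv_polyC. Qed.

Let conv_poly_0 : conv_poly 0 = fun=> 0.
Proof. by apply/funext => g; exact: conv_poly0. Qed.

(** Each factor on the left contains one [phi] and the right side only one, so the other appears as
    [1 - 'X]. Induction on [Q] in Horner form needs only associativity and right convolution by
    [phi]. *)
Lemma conv_poly_mul P Q :
  conv (conv_poly P) (conv_poly Q) = conv_poly (P * Q * (1 - 'X)).
Proof.
have cP := ccontinuous_conv_poly P.
elim/poly_ind: Q => [|Q c ih].
  rewrite mulr0 mul0r conv_poly_0; apply/funext => g; exact: conv0r.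
have cQ := ccontinuous_conv_poly Q.
rewrite conv_poly_MXaddC (convolDr hG hmu cP (ccontinuous_conv_compl cQ) (ccZ _ cphi)).
have cQphi := ccontinuous_conv hG hmu cQ cphi.
apply/funext => g; rewrite convBr// (convolZr hG hmu)// -(convolA hG hmu cP cQ cphi).
rewrite ih !conv_poly_conv_phi -conv_polyZ -conv_polyB -conv_polyD.
congr (conv_poly _ g); rewrite -mul_polyC; ring.
Qed.

Lemma phi_conv_poly P : conv phi (conv_poly P) = conv (conv_poly P) phi.
Proof.
have e1 : conv_poly 1 = phi by apply/funext => g; exact: conv_poly1.
by rewrite -{1}e1 conv_poly_mul mul1r conv_poly_conv_phi.
Qed.

(** The coefficients are real and [phi] is Hermitian. The check reverses the order in a convolution,
    which [phi_conv_poly] undoes. *)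
Lemma fcheck_conv_poly P : fcheck inv (conv_poly P) = conv_poly P.
Proof.
have fphi : fcheck inv phi = phi.
  by apply/funext => g; rewrite /fcheck (pd_hermitian hG pphi) conjcK.
elim/poly_ind: P => [|P c ih].
  by rewrite conv_poly_0; apply/funext => g; rewrite /fcheck rmorph0.
have cP := ccontinuous_conv_poly P.
rewrite conv_poly_MXaddC; apply/funext => g.
rewrite {1}/fcheck rmorphD rmorphM rmorphB /=.
rewrite -/(fcheck inv (conv_poly P) g) -/(fcheck inv (conv (conv_poly P) phi) g).
rewrite -/(fcheck inv phi g) (fcheck_conv hG hmu)// ih fphi phi_conv_poly.
by rewrite conjc_real.
Qed.

Lemma biK_conv_poly (K : set G) P : closed_subgroup mul inv one K ->
  biK_invariant mul K phi -> biK_invariant mul K (conv_poly P).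
Proof.
move=> hK Kphi g k1 k2 K1 K2; apply: eq_bigr => i _; congr (_ * _).
elim: (i : nat) g k1 k2 K1 K2 => //= k ih g k1 k2 K1 K2.
by rewrite /conv_compl ih// (biK_conv hG hmu hK).
Qed.

Lemma Im_conv_poly P g : (forall x, Im (phi x) = 0) -> Im (conv_poly P g) = 0.
Proof.
move=> phi0; have x0 k x : Im (iter k conv_compl phi x) = 0.
  elim: k x => //= k ih x.
  rewrite /conv_compl cImD cImN ih sub0r /convolution /=.
  under eq_Rintegral do rewrite cImM ih phi0 mulr0 mul0r addr0.
  by rewrite Rintegral_cst// mul0r oppr0.
rewrite /conv_poly; elim/big_ind: _ => // [x y xr yr|i _].
  by rewrite cImD xr yr addr0.
by rewrite cImM x0 /= mulr0 mul0r addr0.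
Qed.

(** The functional [tau] transported to polynomials: the value of [P] is [tau(phi * P(1 - phi))], so
    the trace of 1 is the real part of [phi one]. *)
Definition conv_trace P := Re (conv_poly P one).

Lemma conv_traceD P Q : conv_trace (P + Q) = conv_trace P + conv_trace Q.
Proof. by rewrite /conv_trace conv_polyD cReD. Qed.

Lemma conv_traceZ c P : conv_trace (c *: P) = c * conv_trace P.
Proof. by rewrite /conv_trace conv_polyZ cReM /= mul0r subr0. Qed.

Lemma conv_traceB P Q : conv_trace (P - Q) = conv_trace P - conv_trace Q.
Proof. by rewrite conv_traceD -scaleN1r conv_traceZ mulN1r. Qed.

(** As [conv_poly Q] is Hermitian, the inner product is a convolution evaluated at the identity. *)
Lemma inner_conv_poly P Q :
  cintegral mu (fun x => conv_poly P x * (conv_poly Q x)^*) =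
  conv_poly (P * Q * (1 - 'X)) one.
Proof.
rewrite -conv_poly_mul; apply: eq_cintegral => x; congr (_ * _).
by rewrite (grp_mulg1 hG) -[in LHS]fcheck_conv_poly /fcheck conjcK.
Qed.

Lemma sqnorm_conv_poly P :
  sqnorm mu (conv_poly P) = (conv_trace (P * P * (1 - 'X)))%:E.
Proof.
have cP := ccontinuous_conv_poly P.
rewrite /conv_trace -inner_conv_poly /=.
have [iP _] : cintegrable mu (fun x => conv_poly P x * (conv_poly P x)^*).
  apply: (ccontinuous_integrable hG hmu).
  by apply: ccontinuousM => //; exact: ccontinuousJ.
rewrite /Rintegral fineK; last exact: integrable_fin_num iP.
by apply: eq_integral => x _; rewrite -sqmodE.
Qed.

Lemma conv_trace_sqr_ge0 P : 0 <= conv_trace (P * P * (1 - 'X)).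
Proof. by rewrite -lee_fin -sqnorm_conv_poly sqnorm_ge0. Qed.

Hypothesis phi1 : Re (phi one) <= 1.

(** This is [pd_form_le] for [u = conv_poly P]: since [phi one <= 1], the operator [1 - phi],
    written ['X], is nonnegative. *)
Lemma conv_trace_sqrX_ge0 P : 0 <= conv_trace ('X * (P * P) * (1 - 'X)).
Proof.
have cP := ccontinuous_conv_poly P.
have := pd_form_le hG hmu cphi pphi cP.
rewrite conv_poly_conv_phi inner_conv_poly inner_conv_poly.
have i0 : Im (phi one) = 0 by exact: (ger0_Im (pd_one_ge0 hG pphi)).
rewrite cReM i0 mul0r subr0 -/(conv_trace _) -/(conv_trace _).
have := conv_trace_sqr_ge0 P => S0 IS.
rewrite (_ : 'X * _ * _ = P * P * (1 - 'X) - P * (1 - 'X) * P * (1 - 'X)); last by ring.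
rewrite conv_traceB subr_ge0 (le_trans IS)//.
by rewrite -[leRHS]mul1r ler_wpM2r.
Qed.

(** This is [pd_dirac_sub] for [u = conv_poly P], where the Dirac mass minus [u] is represented by
    [1 - P * (1 - 'X)]. *)
Lemma conv_trace_compl_sqr_ge0 P : 0 <= conv_trace ((1 - P * (1 - 'X)) ^+ 2).
Proof.
have cP := ccontinuous_conv_poly P.
have := pd_dirac_sub hG hmu cphi pphi cP.
rewrite conv_poly_conv_phi inner_conv_poly -(conv_poly1 one).
have -> : (2 : R[i]) = (2 : R)%:C by rewrite rmorph_nat.
rewrite -conv_polyZ -conv_polyB -conv_polyD -/(conv_trace _).
congr (0 <= conv_trace _).
by rewrite -mul_polyC polyC_natr; ring.
Qed.

(** For even [k] this is the square norm of the function given by ['X^(k./2)]; for odd [k] one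
    factor ['X] is left over and [conv_trace_sqrX_ge0] applies. *)
Lemma conv_trace_Xn_decr k : 0 <= conv_trace ('X^k * (1 - 'X)).
Proof.
rewrite -(odd_double_half k) addnC exprD -mul2n exprM.
case: (odd k); rewrite ?expr0 ?expr1 ?mulr1.
  rewrite (_ : _ * 'X * _ = 'X * ('X^(k./2) * 'X^(k./2)) * (1 - 'X)).
    exact: conv_trace_sqrX_ge0.
  by rewrite -exprM mulnC exprM expr2; ring.
rewrite (_ : _ ^+ 2 ^+ _ = 'X^(k./2) * 'X^(k./2)).
  exact: conv_trace_sqr_ge0.
by rewrite -exprM mulnC exprM expr2.
Qed.

(** Taking a geometric sum for [P] makes [1 - P * (1 - 'X)] equal to ['X^k], so its square ['X^(2k)]
    has nonnegative trace. Monotonicity carries this to ['X^k], whatever the parity of [k]. *)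
Lemma conv_trace_Xn_ge0 k : 0 <= conv_trace 'X^k.
Proof.
have anti j : conv_trace 'X^(k + j) <= conv_trace 'X^k.
  elim: j => [|j ih]; first by rewrite addn0.
  apply: le_trans ih; rewrite addnS -subr_ge0 -conv_traceB.
  have := conv_trace_Xn_decr (k + j); congr (0 <= conv_trace _).
  by rewrite mulrBr mulr1 -exprSr.
apply: le_trans (anti k).
have := conv_trace_compl_sqr_ge0 (\sum_(i < k) 'X^i).
congr (0 <= conv_trace _).
have -> : 1 - (\sum_(i < k) 'X^i) * (1 - 'X) = 'X^k :> {poly R}.
  have := subrX1 ('X : {poly R}) k.
  set s := \sum_(i < k) _ => E; rewrite (_ : s * (1 - 'X) = - (('X - 1) * s)); last by ring.
  by rewrite -E; ring.
by rewrite -exprM muln2 addnn.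
Qed.

Lemma conv_trace_nneg_mul P Q : coef_ge0 P ->
  (forall k, 0 <= conv_trace ('X^k * Q)) -> 0 <= conv_trace (P * Q).
Proof.
move=> Pn Qk; rewrite -[P]coefK poly_def mulr_suml.
elim/big_ind: _ => [|x y x0 y0|i _].
- by rewrite (_ : conv_trace 0 = 0)// /conv_trace conv_poly0.
- by rewrite conv_traceD addr_ge0.
- by rewrite -scalerAl conv_traceZ mulr_ge0.
Qed.

Lemma conv_trace_nneg P : coef_ge0 P -> 0 <= conv_trace P.
Proof.
move=> Pn; rewrite -[P]mulr1; apply: conv_trace_nneg_mul => // k.
by rewrite mulr1; exact: conv_trace_Xn_ge0.
Qed.

Lemma sqnorm_sqrt_poly_le n : (sqnorm mu (conv_poly (sqrt_poly R n)) <= 1%:E)%E.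
Proof.
rewrite sqnorm_conv_poly lee_fin.
have -> : sqrt_poly R n * sqrt_poly R n * (1 - 'X) =
    1 - 2 *: (sqrt_poly R n.+1 - sqrt_poly R n).
  by rewrite -sqrt_poly_error; ring.
rewrite conv_traceB conv_traceZ.
have := conv_trace_nneg (sqrt_poly_incr_nneg R (leqnSn n)).
have -> : conv_trace 1 = Re (phi one) by rewrite /conv_trace conv_poly1.
by move: phi1; lra.
Qed.

(** The right side exceeds the left by [2 <P - Q, Q>], the trace of a polynomial with nonnegative
    coefficients times [1 - 'X]. *)
Lemma sqnorm_sqrt_polyB m n : (m <= n)%N ->
  (sqnorm mu (fun x => conv_poly (sqrt_poly R n) x - conv_poly (sqrt_poly R m) x)%R
   <= sqnorm mu (conv_poly (sqrt_poly R n)) - sqnorm mu (conv_poly (sqrt_poly R m)))%E.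
Proof.
move=> mn; under [X in sqnorm mu X]eq_fun do rewrite -conv_polyB.
rewrite !sqnorm_conv_poly -EFinB lee_fin -conv_traceB -subr_ge0 -conv_traceB.
set P := sqrt_poly R n; set Q := sqrt_poly R m.
rewrite [X in conv_trace X](_ : _ = (2%:P * ((P - Q) * Q)) * (1 - 'X)).
  apply: conv_trace_nneg_mul; last exact: conv_trace_Xn_decr.
  apply: coef_ge0M; first exact: coef_ge0C.
  by apply: coef_ge0M; [exact: sqrt_poly_incr_nneg|exact: sqrt_poly_nneg].
by rewrite polyC_natr; ring.
Qed.

Lemma sqrt_poly_defect n g : phi g
  - conv (conv_poly (sqrt_poly R n)) (conv_poly (sqrt_poly R n)) g =
  2 * (conv_poly (sqrt_poly R n.+1) g - conv_poly (sqrt_poly R n) g).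
Proof.
rewrite conv_poly_mul -conv_polyB -{1}(conv_poly1 g) -conv_polyB.
have -> : (2 : R[i]) = (2 : R)%:C by rewrite rmorph_nat.
rewrite -conv_polyZ -sqrt_poly_error; congr (conv_poly _ g); ring.
Qed.

End ConvolutionPolynomials.

(** * The limit *)

Section SquareRoot.
Context (R : realType) (G : ptopologicalType).
Variables (mul : G -> G -> G) (inv : G -> G) (one : G).
Variable mu : {measure set (borelT G) -> \bar R}.
Hypothesis hG : compact_group mul inv one.
Hypothesis hmu : haar_probability mul mu.

Local Notation conv := (convolution mul inv mu).

Lemma convol_fcheckE (f : G -> R[i]) g :
  conv f (fcheck inv f) g = cintegral mu (fun h => f h * (f (mul (inv g) h))^*).
Proof.
apply: eq_cintegral => h; rewrite /fcheck; congr (_ * (f _)^*).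
by rewrite (grp_invM hG) (grp_invK hG).
Qed.

(** The difference splits into terms linear in [u - F], one paired with [u] and one with [F].
    Cauchy-Schwarz bounds each by [3 * e], uniformly in [g] because translation preserves the norm.
    The unimodular [z] gives access to both parts of a complex number through [Re]. *)
Lemma convol_fcheck_dist (u F : G -> R[i]) (e : R) (z : R[i]) g :
  cmeasurable (u : borelT G -> R[i]) -> cmeasurable (F : borelT G -> R[i]) ->
  0 < e -> sqmod z = 1 ->
  (sqnorm mu u <= (3 ^+ 2)%:E)%E -> (sqnorm mu F <= (3 ^+ 2)%:E)%E ->
  (sqnorm mu (fun x => u x - F x)%R <= (e ^+ 2)%:E)%E ->
  `|Re (z * (conv u (fcheck inv u) g - conv F (fcheck inv F) g))| <= 6 * e.
Proof.
move=> mu' mF e0 z1 nu nF nd; rewrite !convol_fcheckE.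
have mtr (f : G -> R[i]) : cmeasurable (f : borelT G -> R[i]) ->
    cmeasurable (fun h : borelT G => (f (mul (inv g) h))^*).
  move=> [m1 m2]; apply: cmeasurableJ.
  have mg := measurable_mull hG (inv g).
  by split; [exact: (measurableT_comp m1 mg)|exact: (measurableT_comp m2 mg)].
have ntr (f : G -> R[i]) : cmeasurable (f : borelT G -> R[i]) ->
    sqnorm mu (fun h => (f (mul (inv g) h))^*) = sqnorm mu f.
  by move=> mf; rewrite sqnormJ; exact: (sqnorm_mull hG hmu).
have mUV := cmeasurableB (mtr _ mu') (mtr _ mF).
have nUV : sqnorm mu (fun h => (u (mul (inv g) h))^* - (F (mul (inv g) h))^*)
    = sqnorm mu (fun x => u x - F x).
  rewrite -(ntr _ (cmeasurableB mu' mF)); congr sqnorm; apply/funext => h.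
  by rewrite rmorphB.
have fin f (M : R) : (sqnorm mu f <= M%:E)%E -> (sqnorm mu f < +oo)%E.
  by move=> h; rewrite (le_lt_trans h)// ltry.
pose a h := z * (u h - F h).
pose b h := z * F h.
have mub := cmeasurableB mu' mF.
have ma : cmeasurable (a : borelT G -> R[i]) by exact: cmeasurableZ.
have mb : cmeasurable (b : borelT G -> R[i]) by exact: cmeasurableZ.
have na : (sqnorm mu a <= (e ^+ 2)%:E)%E by rewrite sqnormZ// z1 mul1e.
have nb : (sqnorm mu b <= (3 ^+ 2)%:E)%E by rewrite sqnormZ// z1 mul1e.
have nU := ntr _ mu'; have nV := ntr _ mF.
have -> : z * (cintegral mu (fun h => u h * (u (mul (inv g) h))^*)
    - cintegral mu (fun h => F h * (F (mul (inv g) h))^*)) =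
  cintegral mu (fun h => a h * (u (mul (inv g) h))^*) +
  cintegral mu (fun h => b h * ((u (mul (inv g) h))^* - (F (mul (inv g) h))^*)).
  rewrite mulrBr -!cintegralZ.
  - rewrite -cintegralD; last 2 first.
    + by apply: cintegrableM => //; [exact: mtr|exact: fin na|rewrite nU; exact: fin nu].
    + by apply: cintegrableM => //; [exact: fin nb|rewrite nUV; exact: fin nd].
    rewrite -mulN1r -cintegralZ -?cintegralD.
    + by apply: eq_cintegral => h; rewrite /a /b; ring.
    + apply: cintegrableZ; apply: cintegrableM => //; first exact: mtr.
        exact: fin nu.
      by rewrite nU; exact: fin nu.
    + apply: cintegrableZ; apply: cintegrableZ; apply: cintegrableM => //.
      * exact: mtr.
      * exact: fin nF.
      * by rewrite nV; exact: fin nF.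
    + apply: cintegrableZ; apply: cintegrableM => //; first exact: mtr.
        exact: fin nF.
      by rewrite nV; exact: fin nF.
  - apply: cintegrableM => //; [exact: mtr|exact: fin nF|].
    by rewrite nV; exact: fin nF.
  - apply: cintegrableM => //; [exact: mtr|exact: fin nu|].
    by rewrite nU; exact: fin nu.
rewrite cReD (le_trans (ler_normD _ _))//.
rewrite (_ : 6 * e = e * 3 + 3 * e); last by ring.
apply: lerD => /=.
  by apply: normr_Rintegral_mul => //; [exact: mtr|rewrite nU].
by apply: normr_Rintegral_mul => //; rewrite nUV.
Qed.

Lemma bounded_nondecreasing_cauchy (T : nat -> R) (C : R) :
  {homo T : m n / (m <= n)%N >-> m <= n} -> (forall n, T n <= C) ->
  forall e, 0 < e -> exists N, forall m n, (N <= m)%N -> (m <= n)%N ->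
    T n - T m <= e.
Proof.
move=> ndT TC e e0.
have cT : cvgn T by apply: nondecreasing_is_cvgn => //; exists C => _ [n _ <-].
have [N _ hN] : \forall n \near \oo, `|limn T - T n| <= e.
  by move/cvgrPdist_le : cT; exact.
exists N => m n Nm mn.
have := hN _ (leqnn N); have := nondecreasing_cvgn_le ndT cT n.
have := ndT _ _ Nm; have := ler_norm (limn T - T N); lra.
Qed.

Section Limit.
Variables (K : set G) (phi : G -> R[i]).
Hypothesis hK : closed_subgroup mul inv one K.
Hypothesis cphi : ccont phi.
Hypothesis pphi : positive_definite mul inv phi.
Hypothesis Kphi : biK_invariant mul K phi.
Hypothesis phi1 : Re (phi one) <= 1.

Let f n := conv_poly mul inv mu phi (sqrt_poly R n).

Let cf n : ccont (f n).
Proof. exact: (ccontinuous_conv_poly hG hmu). Qed.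

Let mf n : cmeasurable (f n : borelT G -> R[i]).
Proof. exact: ccontinuous_cmeasurable. Qed.

Let f_cauchy e : 0 < e -> exists N, forall m n, (N <= m)%N -> (N <= n)%N ->
  (sqnorm mu (fun x => f m x - f n x)%R <= e%:E)%E.
Proof.
move=> e0.
have f1 n : (sqnorm mu (f n) <= 1%:E)%E := sqnorm_sqrt_poly_le hG hmu cphi pphi phi1 n.
have ffin n : sqnorm mu (f n) \is a fin_num.
  by rewrite ge0_fin_numE ?sqnorm_ge0// (le_lt_trans (f1 n))// ltry.
pose T n := fine (sqnorm mu (f n)).
have ff m n : (m <= n)%N -> (sqnorm mu (fun x => f n x - f m x)%R <= (T n - T m)%:E)%E.
  move=> mn; rewrite EFinB /T !fineK//.
  exact: (sqnorm_sqrt_polyB hG hmu cphi pphi phi1).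
have ndT : {homo T : m n / (m <= n)%N >-> m <= n}.
  by move=> m n /ff h; rewrite -subr_ge0 -lee_fin (le_trans _ h)// sqnorm_ge0.
have [|N hN] := bounded_nondecreasing_cauchy (C := 1) ndT _ e0.
  by move=> n; rewrite -lee_fin /T fineK.
exists N => m n Nm Nn; have [mn|/ltnW nm] := leqP m n.
  by rewrite sqnormBC (le_trans (ff _ _ mn))// lee_fin; exact: hN.
by rewrite (le_trans (ff _ _ nm))// lee_fin; exact: hN.
Qed.

Lemma convol_square_root_normalized : exists F : G -> R[i],
  [/\ L2 mu F, biK_invariant mul K F, phi = conv F (fcheck inv F) &
      (forall g, Im (phi g) = 0) -> forall g, Im (F g) = 0].
Proof.
have e4 k : 0 < (4^-1 : R) ^+ k by rewrite exprn_gt0// invr_gt0.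
have /choice[N hN] : forall k, exists N, forall m n, (N <= m)%N -> (N <= n)%N ->
    (sqnorm mu (fun x => f m x - f n x)%R <= ((4^-1) ^+ k)%:E)%E.
  by move=> k; exact: f_cauchy.
(* Partial sums dominate every earlier [N k], without arranging that [N] be monotone. *)
pose s k := (\sum_(i < k.+1) N i)%N.
have Ns k j : (k <= j)%N -> (N k <= s j)%N.
  by move=> kj; rewrite /s (bigD1 (Ordinal (kj : k < j.+1)%N))//= leq_addr.
pose u n := f (s n).
have mu' n : cmeasurable (u n : borelT G -> R[i]) := mf (s n).
have hu k m n : (k <= m)%N -> (k <= n)%N ->
    (sqnorm mu (fun x => u m x - u n x)%R <= ((4^-1) ^+ k)%:E)%E.
  by move=> km kn; apply: hN; exact: Ns.
have [mF uF] := sqnorm_cauchy_limit (haar_total hmu) mu' hu.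
set F := (fun x => _ +i* _) in mF uF.
have nu n : (sqnorm mu (u n) <= 1%:E)%E.
  exact: (sqnorm_sqrt_poly_le hG hmu cphi pphi phi1).
have nu3 n : (sqnorm mu (u n) <= (3 ^+ 2)%:E)%E.
  by rewrite (le_trans (nu n))// lee_fin; lra.
(* [2 * 1 + 2 * 2 = 6] is below 9, the square that [convol_fcheck_dist] asks for. *)
have nF3 : (sqnorm mu F <= (3 ^+ 2)%:E)%E.
  apply: (le_trans (sqnorm_le_add mu (mu' 0%N) mF)).
  apply: (@le_trans _ _ (2%:E * 1%:E + 2%:E * (2 * 4^-1 ^+ 0)%:E)%E).
    by apply: leeD; apply: lee_wpmul2l => //; exact: uF.
  by rewrite -!EFinM -EFinD lee_fin expr0; lra.
have geo e : 0 < e -> exists M, forall n, (M <= n)%N -> (2^-1 : R) ^+ n <= e.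
  move=> e0.
  have : (geometric 1 2^-1 : nat -> R) @ \oo --> 0.
    by apply: cvg_geometric; rewrite ger0_norm// invf_lt1// ltr1n.
  move=> /cvgrPdist_le/(_ e e0)[M _ hM]; exists M => n /hM /=.
  by rewrite sub0r normrN mul1r ger0_norm// exprn_ge0// invr_ge0.
have zero z : sqmod z = 1 -> forall g, Re (z * (phi g - conv F (fcheck inv F) g)) = 0.
  move=> z1; pose v n g := Re (z * (phi g - conv (u n) (u n) g)).
  apply: (@uniform_L2_limit_eq0 _ _ _ _ _ _ hG hmu v).
  - move=> n; apply: (ccontinuousM (@ccontinuous_cst R G z) _).1.
    apply: ccontinuousD => //; apply: ccontinuousN.
    by apply: (ccontinuous_conv hG hmu); exact: cf.
  (* The L2 distance of [u n] to [F] is at most [2 * 2^-n], and [convol_fcheck_dist] multiplies it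
     by 6. *)
  - move=> e e0; have [M hM] := geo (e / 12) ltac:(by rewrite divr_gt0).
    exists M => n Mn g.
    have h2 : 0 < (2^-1 : R) ^+ n by rewrite exprn_gt0// invr_gt0.
    have e2 : 0 < 2 * (2^-1 : R) ^+ n by rewrite mulr_gt0.
    have hd : (sqnorm mu (fun x => u n x - F x)%R <= ((2 * 2^-1 ^+ n) ^+ 2)%:E)%E.
      rewrite (le_trans (uF n))// lee_fin exprMn -exprM mulnC exprM.
      rewrite (_ : 2^-1 ^+ 2 = 4^-1 :> R); last by field.
      by rewrite ler_wpM2r ?(ltW (e4 _))//; lra.
    have := convol_fcheck_dist g (mu' n) mF e2 z1 (nu3 n) nF3 hd.
    have -> : fcheck inv (u n) = u n by exact: (fcheck_conv_poly hG hmu cphi pphi).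
    have -> : z * (conv (u n) (u n) g - conv F (fcheck inv F) g) =
        z * (phi g - conv F (fcheck inv F) g) - z * (phi g - conv (u n) (u n) g).
      by ring.
    rewrite cReD cReN -/(v n g) => /le_trans; apply.
    by have := hM _ Mn; lra.
  - move=> e e0; have [M hM] := geo (e / 4) ltac:(by rewrite divr_gt0).
    exists M => n Mn.
    apply: (@le_trans _ _ (sqnorm mu (fun g => 2 * (f (s n).+1 g - f (s n) g))%R)).
      have vE g : v n g = Re (z * (2 * (f (s n).+1 g - f (s n) g))).
        by rewrite /v (sqrt_poly_defect hG hmu cphi).
      have m2 := cmeasurableZ 2 (cmeasurableB (mf (s n).+1) (mf (s n))).
      apply: ge0_le_integral => //.
      + by move=> x _; rewrite lee_fin sqr_ge0.
      + apply/measurable_EFinP; apply: measurable_funX.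
        rewrite (funext vE : v n = _); exact: (cmeasurableZ z m2).1.
      + by apply/measurable_EFinP; exact: measurable_sqmod.
      + move=> x _; rewrite lee_fin vE.
        by rewrite -[leRHS]mul1r -z1 -sqmodM /sqmod lerDl sqr_ge0.
    rewrite sqnormZ; last exact: cmeasurableB.
    (* The defect compares consecutive iterates of [f], not consecutive terms of the subsequence
       [u], hence the use of [hN] at [(s n).+1]. *)
    have := hN n (s n).+1 (s n) (leqW (Ns _ _ (leqnn n))) (Ns _ _ (leqnn n)).
    have -> : sqmod (2 : R[i]) = 4.
      by rewrite /sqmod /=; ring.
    move=> h; apply: (@le_trans _ _ (4%:E * ((4^-1) ^+ n)%:E)%E).
      exact: lee_wpmul2l.
    rewrite -EFinM lee_fin.
    have : (4^-1 : R) ^+ n <= 2^-1 ^+ n.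
      by rewrite lerXn2r ?nnegrE ?invr_ge0// lef_pV2 ?posrE//; lra.
    by have := hM _ Mn; lra.
exists F; split.
- by case: mF => m1 m2; split => //; apply: (le_lt_trans nF3); rewrite ltry.
- move=> g k1 k2 K1 K2; have uK n : u n (mul (mul k1 g) k2) = u n g.
    exact: (biK_conv_poly hG hmu cphi (sqrt_poly R (s n)) hK Kphi).
  by rewrite /F /limsup_fun; congr (_ +i* _); congr fine; congr limn_esup;
    apply/funext => n; rewrite uK.
- apply/funext => g; apply/eqP; rewrite -subr_eq0; apply/eqP; apply: complexP.
    by rewrite -[X in Re X]mul1r zero// /sqmod /= expr1n expr0n addr0.
  (* [Re ('i * w)] is [- Im w], so testing with ['i] settles the imaginary part. *)
  have := zero 'i _ g; rewrite cReM /= mul0r mul1r sub0r => h.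
  by apply: oppr_inj; rewrite h ?oppr0// /sqmod /= expr1n expr0n add0r.
- move=> phi0 g; rewrite /F /= /limsup_fun.
  have -> : (fun n => (Im (u n g))%:E) = cst (0 : R)%:E.
    by apply/funext => n; rewrite /u /f Im_conv_poly.
  by have [_ ->] := cvg_limn_einf_sup (@cvg_cst _ (0 : R)%:E nat \oo _).
Qed.

End Limit.

Lemma convol_square_root (K : set G) (phi : G -> R[i]) :
  closed_subgroup mul inv one K -> ccont phi -> positive_definite mul inv phi ->
  biK_invariant mul K phi ->
  exists F : G -> R[i],
  [/\ L2 mu F, biK_invariant mul K F, phi = conv F (fcheck inv F) &
      (forall g, Im (phi g) = 0) -> forall g, Im (F g) = 0].
Proof.
move=> hK cphi pphi Kphi.
have r0 : 0 <= Re (phi one).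
  by have := pd_one_ge0 hG pphi; rewrite lecE => /andP[].
(* Dividing [phi] by [t] reaches the normalized case, and the root is multiplied by the square root
   of [t]. The summand 1 keeps [t] positive when [phi one] is 0. *)
pose t := 1 + Re (phi one).
have t0 : 0 < t by rewrite ltr_pwDl.
pose psi g := (t^-1)%:C * phi g.
have cpsi : ccont psi by apply: ccontinuousM => //; exact: ccontinuous_cst.
have ppsi : positive_definite mul inv psi.
  move=> m g xi; have tC : 0 <= (t^-1)%:C by rewrite ler0c invr_ge0 ltW.
  have := mulr_ge0 tC (pphi m g xi); congr (0 <= _).
  by rewrite mulr_sumr; apply: eq_bigr => i _; rewrite mulr_sumr;
    apply: eq_bigr => j _; rewrite /psi !mulrA.
have Kpsi : biK_invariant mul K psi.
  by move=> g k1 k2 K1 K2; rewrite /psi Kphi.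
have psi1 : Re (psi one) <= 1.
  rewrite /psi cReM /= mul0r subr0 mulrC ler_pdivrMr// mul1r /t; lra.
have [F [[m1 m2 nF] KF psiF imF]] := convol_square_root_normalized hK cpsi ppsi Kpsi psi1.
have mF : cmeasurable (F : borelT G -> R[i]) by [].
pose c : R[i] := (Num.sqrt t)%:C.
have [mc1 mc2] := cmeasurableZ c mF.
exists (fun g => c * F g); split.
- split => //; have := sqnormZ mu c mF; rewrite /sqnorm => ->.
  by rewrite lte_mul_pinfty ?lee_fin ?sqmod_ge0.
- by move=> g k1 k2 K1 K2; rewrite KF.
- apply/funext => g.
  have -> : phi g = t%:C * psi g.
    by rewrite /psi mulrA -rmorphM mulfV ?gt_eqF// mul1r.
  rewrite psiF !convol_fcheckE -cintegralZ.
    apply: eq_cintegral => h; rewrite rmorphM /= conjc_real.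
    have -> : t%:C = c * c by rewrite -rmorphM -expr2 sqr_sqrtr// ltW.
    by ring.
  have mg := measurable_mull hG (inv g).
  have mtr : cmeasurable (fun h : borelT G => F (mul (inv g) h)).
    by split; [exact: (measurableT_comp m1 mg)|exact: (measurableT_comp m2 mg)].
  apply: cintegrableM => //; first exact: cmeasurableJ.
  by rewrite sqnormJ (sqnorm_mull hG hmu).
- move=> phi0 g; rewrite cImM /= mul0r addr0 imF ?mulr0// => x.
  by rewrite /psi cImM phi0 /= mul0r mulr0 addr0.
Qed.

End SquareRoot.

Theorem theorem3p4 (R : realType) (G : ptopologicalType)
    (mul : G -> G -> G) (inv : G -> G) (one : G)
    (mu : {measure set (borelT G) -> \bar R})
    (K : set G) (phi : G -> R[i]) :
  compact_group mul inv one ->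
  haar_probability mul mu ->
  closed_subgroup mul inv one K ->
  ccontinuous phi ->
  positive_definite mul inv phi ->
  biK_invariant mul K phi ->
  (exists f : G -> R[i],
      [/\ L2 mu f, biK_invariant mul K f &
          phi = convolution mul inv mu f (fcheck inv f)]) /\
  ((forall g, complex.Im (phi g) = 0) ->
   exists f : G -> R[i],
      [/\ L2 mu f, biK_invariant mul K f, (forall g, complex.Im (f g) = 0) &
          phi = convolution mul inv mu f (fcheck inv f)]).
Proof.
move=> hG hmu hK cphi pphi Kphi.
have [F [L2F KF phiF imF]] := convol_square_root hG hmu hK cphi pphi Kphi.
by split=> [|phi0]; exists F; split => //; exact: imF.
Qed.
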